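(* Let $\Omega\subset\mathbb{R}^n$ be a bounded open Lipschitz domain, $\alpha\in(0,1)$, $\epsilon>0$, $T>0$. Let $P=\Omega\times(0,T]$ and $\Gamma=\partial\Omega\times(0,T)\,\cup\,\Omega\times\{t=0\}$. Assume that $k:P\to\mathbb{R}$ is a bounded continuous function and there exists a constant $k_0>0$ such that $k(x,t)\ge k_0>0$ for all $(x,t)\in P$. Suppose $u\in C^{1,1}(P)\cap C(\overline P)\cap C([0,T],\mathbb{H}^{2\alpha}(\Omega))$ satisfies the differential inequality $$k(x,t)\,\partial_t u+\mathcal{L}u+c(u)\,u\ge0\quad\text{in }P,$$ and the boundary condition $\min_\Gamma u(x,t)\ge0$, where $\mathcal{L}:=\epsilon^2(-\Delta)^\alpha+\nabla$, with $\nabla u:=\sum_{i=1}^n\partial_{x_i}u$, and $c:\mathbb{R}\to\mathbb{R}$ satisfies $c(u)\ge-c_0$ with a constant $c_0>0$. Then $$\min_{\overline P}u(x,t)\ge0.$$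
   Context: $C^{1,1}(P)$ denotes the set of functions on $P$ that are continuously differentiable with respect to $x$ and continuously differentiable with respect to $t$. Let $\{(\lambda_k,\varphi_k)\}_{k\ge1}$ be the Dirichlet eigenpairs of $-\Delta$ on $\Omega$, with $\{\varphi_k\}$ an orthonormal basis of $L^2(\Omega)$, and $u_k=\int_\Omega u\varphi_k\,dx$. The spectral fractional Laplacian (acting in $x$) is $(-\Delta)^\alpha u=\sum_k\lambda_k^\alpha u_k\varphi_k$, with domain $\mathbb{H}^{2\alpha}(\Omega)=\{u\in L^2(\Omega):\sum_k\lambda_k^{2\alpha}|u_k|^2<\infty\}$ normed by $(\sum_k\lambda_k^{2\alpha}|u_k|^2)^{1/2}$. *)

(* Defs.v *)
From HB Require Import structures.
From mathcomp Require Import all_boot all_order all_algebra.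
From mathcomp Require Import all_classical all_reals all_analysis.

Set Implicit Arguments.
Unset Strict Implicit.
Unset Printing Implicit Defensive.

Import Order.TTheory GRing.Theory Num.Theory.
Import numFieldNormedType.Exports.

Local Open Scope classical_set_scope.
Local Open Scope ring_scope.

(** 'rV[R]_n carries the sigma-algebra generated by the coordinate maps, i.e. the
    Borel sigma-algebra; every class of L^2 has a Borel representative, so
    completing the sigma-algebra is not needed. *)

Definition rV_display : measure_display. Proof. exact: default_measure_display. Qed.

Section rV_measurable.
Context {R : realType} {n : nat}.

Definition rV_coord (i : 'I_n) (x : 'rV[R]_n) : measurableTypeR R := x ord0 i.

Let rV_measurable : set (set 'rV[R]_n) := g_sigma_preimage rV_coord.

Let rV_set0 : rV_measurable set0.
Proof. exact: sigma_algebra0. Qed.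

Let rV_setC A : rV_measurable A -> rV_measurable (~` A).
Proof. exact: sigma_algebraC. Qed.

Let rV_bigcup (F : (set 'rV[R]_n)^nat) :
  (forall i, rV_measurable (F i)) -> rV_measurable (\bigcup_i (F i)).
Proof. exact: sigma_algebra_bigcup. Qed.

HB.instance Definition _ := @isMeasurable.Build rV_display
  'rV[R]_n rV_measurable rV_set0 rV_setC rV_bigcup.

Lemma measurable_rV_coord (i : 'I_n) : measurable_fun [set: 'rV[R]_n] (rV_coord i).
Proof.
move=> _ Y mY; rewrite setTI; apply: sub_sigma_algebra => /=.
rewrite -bigcup_seq/=; exists i => /=; first by rewrite mem_index_enum.
by exists Y => //; rewrite setTI.
Qed.

Lemma measurable_fun_rVP d (T : measurableType d) (f : T -> 'rV[R]_n) :
  (forall i, measurable_fun [set: T] (rV_coord i \o f)) ->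
  measurable_fun [set: T] f.
Proof.
move=> mf _ A mA; rewrite setTI.
suff: g_sigma_preimage (fun i => rV_coord i \o f) `<=` measurable.
  apply; rewrite g_sigma_preimage_comp.
  by exists A => //; rewrite setTI.
apply: smallest_sub; first exact: sigma_algebra_measurable.
move=> B; rewrite -bigcup_seq => -[i _] /= [C mC <-].
exact: mf.
Qed.

End rV_measurable.

Section rV_cons.
Context {R : realType} {n : nat}.

Definition rV_cons (p : measurableTypeR R * 'rV[R]_n) : 'rV[R]_n.+1 :=
  row_mx (const_mx p.1 : 'rV[R]_1) p.2.

Definition rV_uncons (x : 'rV[R]_n.+1) : measurableTypeR R * 'rV[R]_n :=
  (x ord0 ord0, rsubmx (x : 'rV[R]_(1 + n))).

Lemma rV_consK : cancel rV_cons rV_uncons.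
Proof.
move=> [a x]; rewrite /rV_uncons /rV_cons /= row_mxKr; congr pair.
have -> : ord0 = lshift n (ord0 : 'I_1) by apply/val_inj.
by rewrite (row_mxEl (const_mx a : 'rV[R]_1)) mxE.
Qed.

Lemma measurable_rV_cons : measurable_fun setT rV_cons.
Proof.
apply: measurable_fun_rVP => i.
have [->|i0] := eqVneq i ord0.
  rewrite (_ : _ \o _ = fst); first exact: measurable_fst.
  apply/funext => -[a x]; rewrite /rV_coord /rV_cons /=.
  have -> : ord0 = lshift n (ord0 : 'I_1) :> 'I_n.+1 by apply/val_inj.
  by rewrite (row_mxEl (const_mx a : 'rV[R]_1)) mxE.
have i1n : (i.-1 < n)%N by case: i i0 => -[|i]// + _; rewrite ltnS.
pose j := Ordinal i1n.
rewrite (_ : _ \o _ = rV_coord j \o snd).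
  by apply: measurableT_comp => //; exact: measurable_rV_coord.
apply/funext => -[a x]; rewrite /rV_coord /rV_cons /=.
have -> : i = rshift 1 j :> 'I_n.+1.
  by apply/val_inj => /=; rewrite add1n prednK// lt0n.
by rewrite (row_mxEr (const_mx a : 'rV[R]_1)).
Qed.

Lemma measurable_rV_uncons : measurable_fun setT rV_uncons.
Proof.
apply/measurable_fun_pair; first exact: measurable_rV_coord.
apply: measurable_fun_rVP => i.
rewrite (_ : _ \o _ = rV_coord (rshift 1 i : 'I_n.+1)).
  exact: measurable_rV_coord.
by apply/funext => x; rewrite /rV_coord /= mxE.
Qed.

Variable mu : {sigma_finite_measure set 'rV[R]_n -> \bar R}.

Definition lebesgue_rV_step : set 'rV[R]_n.+1 -> \bar R :=
  pushforward (@lebesgue_measure R \x mu)%E rV_cons.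

Let measurable_rV_cons_preimage A : measurable A -> measurable (rV_cons @^-1` A).
Proof. by move=> mA; rewrite -[X in measurable X]setTI; exact: measurable_rV_cons. Qed.

Let lebesgue_rV_step0 : lebesgue_rV_step set0 = 0%E.
Proof. by rewrite /lebesgue_rV_step /pushforward preimage_set0 measure0. Qed.

Let lebesgue_rV_step_ge0 A : (0 <= lebesgue_rV_step A)%E.
Proof. by rewrite /lebesgue_rV_step /pushforward measure_ge0. Qed.

Let lebesgue_rV_step_sigma_additive : semi_sigma_additive lebesgue_rV_step.
Proof.
move=> F mF tF mUF; rewrite /lebesgue_rV_step /pushforward preimage_bigcup.
apply: measure_semi_sigma_additive.
- by move=> i; exact: measurable_rV_cons_preimage.
- apply/trivIsetP => /= i j _ _ ij; rewrite -preimage_setI.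
  by move/trivIsetP : tF => /(_ _ _ _ _ ij) ->//; rewrite preimage_set0.
- by rewrite -preimage_bigcup; exact: measurable_rV_cons_preimage.
Qed.

HB.instance Definition _ := isMeasure.Build _ _ _ lebesgue_rV_step
  lebesgue_rV_step0 lebesgue_rV_step_ge0 lebesgue_rV_step_sigma_additive.

Let lebesgue_rV_step_sigma_finite : sigma_finite setT lebesgue_rV_step.
Proof.
have /sigma_finiteP[F [TF ndF Foo]] := sigma_finiteT (@lebesgue_measure R).
have /sigma_finiteP[G [TG ndG Goo]] := sigma_finiteT mu.
exists (fun i => rV_uncons @^-1` (F i `*` G i)).
  rewrite -preimage_bigcup [X in _ @^-1` X](_ : _ = setT) ?preimage_setT//.
  rewrite -subTset => -[x y] _.
  have [i _ Fix] : (\bigcup_i F i) x by rewrite -TF.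
  have [j _ Gjy] : (\bigcup_i G i) y by rewrite -TG.
  exists (maxn i j) => //; split.
  - by move: x Fix; exact/subsetPset/ndF/leq_maxl.
  - by move: y Gjy; exact/subsetPset/ndG/leq_maxr.
move=> i; have [mF Fioo] := Foo i; have [mG Gioo] := Goo i; split.
  rewrite -[X in measurable X]setTI; apply: measurable_rV_uncons => //.
  exact: measurableX.
rewrite /lebesgue_rV_step /pushforward -comp_preimage.
rewrite (_ : rV_uncons \o rV_cons = id); last first.
  by apply/funext => p; exact: rV_consK.
by rewrite preimage_id product_measure1E// lte_mul_pinfty// ge0_fin_numE.
Qed.

HB.instance Definition _ := Measure_isSigmaFinite.Build _ _ _ lebesgue_rV_step
  lebesgue_rV_step_sigma_finite.

End rV_cons.

(** Iterated product: R^0 carries the unit mass at its only point, and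
    R^(1 + n) = R x R^n the product measure. *)
Fixpoint lebesgue_rV {R : realType} (n : nat) :
    {sigma_finite_measure set 'rV[R]_n -> \bar R} :=
  match n with
  | 0 => @dirac _ 'rV[R]_0 0 R
  | n.+1 => lebesgue_rV_step (lebesgue_rV n)
  end.

(** Balls and distances of 'rV[R]_n are those of the sup norm; boundedness and
    the Lipschitz property do not depend on the choice of the norm. *)

Definition is_domain {R : realType} {n : nat} (Omega : set 'rV[R]_n) : Prop :=
  [/\ Omega !=set0, open Omega & connected Omega].

Definition boundary {T : topologicalType} (A : set T) : set T :=
  closure A `\` interior A.

(** Near each boundary point, after an orthogonal change of coordinates
    [x *m Q], Omega is the set lying above the graph of a Lipschitz function
    of the first n coordinates. *)
Definition lipschitz_boundary {R : realType} {n : nat}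
    (Omega : set 'rV[R]_n.+1) : Prop :=
  forall z, boundary Omega z ->
  exists (r : R) (Q : 'M[R]_n.+1) (g : 'rV[R]_n -> R),
    [/\ 0 < r, Q *m Q^T = 1%:M,
        exists L : R, L.-lipschitz g &
        forall x, ball z r x ->
          (Omega x <-> g (col' ord_max (x *m Q)) < (x *m Q) ord0 ord_max)].

Section space_functions.
Context {R : realType} {n : nat}.
Implicit Types (Omega : set 'rV[R]_n) (f g psi : 'rV[R]_n -> R).

Definition pderiv (i : 'I_n) f (x : 'rV[R]_n) : R := 'D_(delta_mx ord0 i) f x.

Definition smooth f : Prop :=
  forall s : seq 'I_n, let fs := foldr pderiv f s in
    continuous fs /\ forall i x, derivable fs x (delta_mx ord0 i).

Definition test_function Omega psi : Prop :=
  smooth psi /\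
  exists K, [/\ compact K, K `<=` Omega & forall x, ~ K x -> psi x = 0].

Definition inner Omega f g : R := \int[lebesgue_rV n]_(x in Omega) (f x * g x).

Definition in_L2 Omega f : Prop :=
  measurable_fun Omega f /\
  (lebesgue_rV n).-integrable Omega (fun x => (f x ^+ 2)%:E).

Definition cvg_L2 Omega (F : nat -> 'rV[R]_n -> R) f : Prop :=
  (\int[lebesgue_rV n]_(x in Omega) ((F N x - f x) ^+ 2)%:E)%E
    @[N --> \oo] --> 0%E.

(** f belongs to H^1_0(Omega), the closure of C_c^oo(Omega) in H^1(Omega), and
    G is its weak gradient. *)
Definition in_H10 Omega f (G : 'I_n -> 'rV[R]_n -> R) : Prop :=
  [/\ in_L2 Omega f, forall i, in_L2 Omega (G i) &
      exists psi : nat -> 'rV[R]_n -> R,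
        [/\ forall m, test_function Omega (psi m),
            cvg_L2 Omega psi f &
            forall i, cvg_L2 Omega (fun m => pderiv i (psi m)) (G i)]].

(** Weak form of  - Delta phi = lambda phi in Omega, phi = 0 on the boundary,
    phi <> 0. *)
Definition dirichlet_eigenpair Omega (lambda : R) phi : Prop :=
  inner Omega phi phi != 0 /\
  exists G, in_H10 Omega phi G /\
    forall psi, test_function Omega psi ->
      \sum_(i < n) inner Omega (G i) (pderiv i psi) =
      lambda * inner Omega phi psi.

Definition orthonormal_basis_L2 Omega (phi : nat -> 'rV[R]_n -> R) : Prop :=
  [/\ forall j, in_L2 Omega (phi j),
      forall j l, inner Omega (phi j) (phi l) = (j == l)%:R &
      forall f, in_L2 Omega f ->
        cvg_L2 Omega (fun N x => \sum_(j < N) inner Omega f (phi j) * phi j x) f].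

Definition dirichlet_eigenbasis Omega (lambda : nat -> R)
    (phi : nat -> 'rV[R]_n -> R) : Prop :=
  (forall j, dirichlet_eigenpair Omega (lambda j) (phi j)) /\
  orthonormal_basis_L2 Omega phi.

Section spectral.
Variables (Omega : set 'rV[R]_n) (lambda : nat -> R)
  (phi : nat -> 'rV[R]_n -> R).

Definition spectral_sum (s : R) f : \bar R :=
  (\sum_(0 <= j <oo) (lambda j `^ s * inner Omega f (phi j) ^+ 2)%:E)%E.

Definition in_Hs (s : R) f : Prop :=
  in_L2 Omega f /\ (spectral_sum s f < +oo)%E.

Definition Hs_norm (s : R) f : R := Num.sqrt (fine (spectral_sum s f)).

(** f lies in the domain of (- Delta)^alpha and g is a representative of the
    class (- Delta)^alpha f of L^2(Omega). *)
Definition is_frac_laplacian (alpha : R) f g : Prop :=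
  [/\ in_Hs (2 * alpha) f, in_L2 Omega g &
      cvg_L2 Omega (fun N x => \sum_(j < N)
        lambda j `^ alpha * inner Omega f (phi j) * phi j x) g].

End spectral.

End space_functions.

Section spacetime.
Context {R : realType} {n : nat}.
Variables (Omega : set 'rV[R]_n) (T : R).
Implicit Types u : 'rV[R]_n * R -> R.

Definition cylinder : set ('rV[R]_n * R) :=
  [set p | Omega p.1 /\ 0 < p.2 <= T].

Definition parabolic_boundary : set ('rV[R]_n * R) :=
  [set p | boundary Omega p.1 /\ 0 < p.2 < T] `|`
  [set p | Omega p.1 /\ p.2 = 0].

Definition dx u (i : 'I_n) (p : 'rV[R]_n * R) : R :=
  pderiv i (fun x => u (x, p.2)) p.1.

(** The time derivative is taken within ]0, T], hence is one-sided at t = T. *)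
Definition dt_filter u (p : 'rV[R]_n * R) : set_system R :=
  (u (p.1, s) - u p) / (s - p.2)
    @[s --> within [set s | 0 < s <= T] (dnbhs p.2)].

Definition dt u (p : 'rV[R]_n * R) : R := lim (dt_filter u p).

Definition C11 u : Prop :=
  [/\ forall p, cylinder p -> forall i : 'I_n,
        derivable (fun x => u (x, p.2)) p.1 (delta_mx ord0 i),
      forall p, cylinder p -> cvg (dt_filter u p),
      forall i : 'I_n, {within cylinder, continuous (dx u i)} &
      {within cylinder, continuous (dt u)}].

Definition continuous_in_Hs (lambda : nat -> R) (phi : nat -> 'rV[R]_n -> R)
    (s : R) u : Prop :=
  (forall t, 0 <= t <= T -> in_Hs Omega lambda phi s (fun x => u (x, t))) /\
  (forall t, 0 <= t <= T ->
    Hs_norm Omega lambda phi s (fun x => u (x, t') - u (x, t))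
      @[t' --> within [set t' | 0 <= t' <= T] (nbhs t)] --> (0 : R)).

End spacetime.

Definition is_min {S : Type} {R : realType} (A : set S) (f : S -> R) (m : R) :
    Prop :=
  (exists2 p, A p & f p = m) /\ forall p, A p -> m <= f p.

(* Main.v *)
Require Import Defs.
From HB Require Import structures.
From mathcomp Require Import all_boot all_order all_algebra.
From mathcomp Require Import all_classical all_reals all_analysis.
From mathcomp Require Import measurable_realfun ring lra.
Import Order.TTheory GRing.Theory Num.Theory.
Import numFieldNormedType.Exports.
Set Implicit Arguments.
Unset Strict Implicit.
Unset Printing Implicit Defensive.
Local Open Scope classical_set_scope.
Local Open Scope ring_scope.

(** Why the theorem holds.

    Suppose that u is negative somewhere.  With beta = 4 c0 / k0, the function
    exp (- beta t) u (x, t) has a negative minimum on the compact closure of the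
    cylinder, at a point (x0, t0) which the boundary condition forces into the
    cylinder itself ([cylinder_of_neg]).  Put w = u (., t0) and m = w x0.  Every
    minimizer x of w yields a minimum (x, t0) of the weighted function, so there
    the space derivatives vanish ([derive_min]) and the weight imposes
    d_t u <= beta m / 2 ([dt_min]).  Hence k d_t u + sum_i d_i u - c0 w is
    negative at the minimizers of w and, by compactness, on a whole sublevel set
    {w < a} with m < a < 0.  On that set the differential inequality makes
    g = (- Delta)^alpha w positive almost everywhere.

    This contradicts the inequality <g, max (w, a) - w> <= 0, valid for every
    a < 0 ([inner_frac_laplacian_le0]), because max (w, a) - w is nonnegative and
    positive exactly on {w < a}, an open nonempty set, hence a set of positive
    measure ([lebesgue_rV_open_gt0]).  Writing f_j for the coefficients
    <f, phi_j>, the elementary inequality 2 x (y - x) <= y^2 - x^2 bounds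
    2 <g, max (w, a) - w> by E (max (w, a)) - E (w), where
    E (f) = sum_j lambda_j^alpha f_j^2; so all that matters is that truncation
    decreases the fractional energy E ([frac_energy_maxr]).

    Up to a constant factor, lambda^alpha is the integral over the real line of
    exp (alpha y) lambda / (lambda + exp y) ([integral_yosida_density]).  By
    Tonelli it is enough to treat the forms sum_j lambda_j / (lambda_j + s) f_j^2
    with s > 0 ([yosida_series_maxr]).  Such a form is the minimum over v of
        s^-1 int |grad v|^2 + || v - f ||^2,
    and both terms decrease when v and f are replaced by max (v, a) and
    max (f, a).  To make this argument with test functions only, v is taken to be
    a finite combination of eigenfunctions, which is a limit in H^1 of test
    functions psi, and max (., a) is replaced by a smooth function of slope at
    most 1 which vanishes at 0, so that its composite chi with psi is again a
    test function with |d_i chi| <= |d_i psi|.  The spectral energy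
    sum_j lambda_j chi_j^2 is controlled by int |grad chi|^2 because the gradients
    of the eigenfunctions are orthogonal: this is Bessel's inequality for them
    ([energy_ge_spectral]). *)

(** * Borel sets and open sets of row vectors *)

Section rV_borel.
Context {R : realType}.

Lemma rV_ballP n (x y : 'rV[R]_n) (r : R) :
  ball x r y <-> 0 < r /\ forall j, `|x ord0 j - y ord0 j| < r.
Proof.
split=> [[r0 xy]|[r0 xy]]; split=> // i; first exact: xy.
by move=> j; rewrite (ord1 i); exact: xy.
Qed.

Lemma measurable_rV_ball n (x : 'rV[R]_n) (r : R) : measurable (ball x r).
Proof.
have [r0|r0] := ltP 0 r; last first.
  rewrite (_ : ball x r = set0)// -subset0 => y /rV_ballP[].
  by rewrite ltNge r0.
rewrite (_ : ball x r =
    \bigcap_(j in [set: 'I_n]) (rV_coord j @^-1` ball (x ord0 j) r)).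
  apply: fin_bigcap_measurable => //.
  move=> j _; rewrite -[X in measurable X]setTI.
  by apply: measurable_rV_coord => //; exact: measurable_ball.
apply/seteqP; split => [y /rV_ballP[_ xy] j _|y xy]; first exact: xy.
by apply/rV_ballP; split => // j; exact: xy.
Qed.

(** The sigma-algebra is generated by the coordinates, and an open set is a
    countable union of balls with rational centres and radii 1 / (k + 1); balls
    are boxes. *)
Lemma measurable_rV_open n (U : set 'rV[R]_n) : open U -> measurable U.
Proof.
move=> oU.
pose q2r (q : 'rV[rat]_n) : 'rV[R]_n := map_mx ratr q.
pose D := [set p : 'rV[rat]_n * nat | ball (q2r p.1) (p.2.+1%:R^-1) `<=` U].
pose F (p : 'rV[rat]_n * nat) : set 'rV[R]_n :=
  if p \in D then ball (q2r p.1) (p.2.+1%:R^-1) else set0.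
rewrite (_ : U = \bigcup_p F p).
  apply: countable_bigcupT_measurable; first exact: countableP.
  by move=> p; rewrite /F; case: ifP => // _; exact: measurable_rV_ball.
apply/seteqP; split => [x Ux|x [p _]]; last first.
  by rewrite /F; case: ifPn => //; rewrite inE => /[apply].
have /nbhs_ballP[r /= r0 xrU] : nbhs x U by exact: open_nbhs_nbhs.
have [k kr] : exists k : nat, k.+1%:R^-1 < r / 2.
  have r20 : 0 < r / 2 by rewrite divr_gt0.
  by have [k _ /(_ k (leqnn k))] := near_infty_natSinv_lt (PosNum r20); exists k.
have k0 : 0 < k.+1%:R^-1 :> R by rewrite invr_gt0.
have xq (j : 'I_n) : {q : rat | `|ratr q - x ord0 j| < k.+1%:R^-1}.
  apply/cid; have /rat_in_itvoo[q] : x ord0 j - k.+1%:R^-1 < x ord0 j + k.+1%:R^-1.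
    by rewrite ltrBlDr -addrA ltrDl addr_gt0.
  by rewrite in_itv/= => qx; exists q; rewrite ltr_distl.
pose q j := sval (xq j).
exists (\row_j q j, k) => //.
have xqb : ball (q2r (\row_j q j)) k.+1%:R^-1 x.
  by apply/rV_ballP; split => // j; rewrite !mxE; exact: (svalP (xq j)).
rewrite /F ifT// inE /D /= => y yb; apply: xrU.
have -> : r = r / 2 + r / 2 by rewrite -splitr.
apply: (@ball_triangle _ _ (q2r (\row_j q j))).
- by apply: le_ball (ball_sym xqb); exact: ltW.
- by apply: le_ball yb; exact: ltW.
Qed.

Lemma continuous_rV_measurable_fun n (f : 'rV[R]_n -> R) (D : set 'rV[R]_n) :
  measurable D -> continuous f -> measurable_fun D f.
Proof.
move=> mD /continuousP cf; apply: (measurability _ (RGenOpens.measurableE R)).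
move=> _ [_ [a [b ->] <-]]; apply: measurableI => //; apply: measurable_rV_open.
exact/cf/interval_open.
Qed.

(** Balls are boxes, so the inductive step is the product formula. *)
Lemma lebesgue_rV_ball_gt0 n (x : 'rV[R]_n) (r : R) : 0 < r ->
  (0 < lebesgue_rV n (ball x r))%E.
Proof.
move=> r0; elim: n x => [|n IH] x.
  rewrite /= diracE mem_set ?lte01//.
  by apply/rV_ballP; split => // -[].
rewrite /= /lebesgue_rV_step /pushforward.
pose x' : 'rV[R]_n := rsubmx (x : 'rV[R]_(1 + n)).
rewrite [X in (_ \x _)%E X](_ : _ = ball (x ord0 ord0) r `*` ball x' r).
  rewrite product_measure1E//; [|exact: measurable_ball|exact: measurable_rV_ball].
  by rewrite mule_gt0//= lebesgue_measure_ball ?ltW// lte_fin mulrn_wgt0.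
apply/seteqP; split => [[a y] /rV_ballP[_ H]|[a y] [/= H0 /rV_ballP[_ H]]].
  have K1 := rV_consK (a, y).
  case: K1 => Ka Ky.
  split; first by rewrite /= -Ka; exact: H.
  apply/rV_ballP; split => // j; rewrite /= -Ky !mxE.
  by have := H (rshift 1 j); rewrite !mxE.
have [Ka Ky] := rV_consK (a, y).
apply/rV_ballP; split => // j.
have [->|j0] := eqVneq j ord0; first by rewrite Ka.
have jn : (j.-1 < n)%N by case: j j0 => -[|j].
have -> : j = rshift 1 (Ordinal jn) :> 'I_(1 + n).
  by apply/val_inj/esym/(@prednK (val j)); rewrite lt0n.
by have := H (Ordinal jn); rewrite -{1}Ky !mxE.
Qed.

Lemma lebesgue_rV_open_gt0 n (U : set 'rV[R]_n) : open U -> U !=set0 ->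
  (0 < lebesgue_rV n U)%E.
Proof.
move=> oU [x Ux].
have /nbhs_ballP[r /= r0 xrU] : nbhs x U by exact: open_nbhs_nbhs.
apply: lt_le_trans (lebesgue_rV_ball_gt0 x r0) _.
by apply: le_measure => //; rewrite inE;
  [exact: measurable_rV_ball|exact: measurable_rV_open].
Qed.

End rV_borel.

(** * Square integrable functions *)

Section L2.
Context {R : realType} {n : nat} (Omega : set 'rV[R]_n).
Hypothesis mOmega : measurable Omega.
Implicit Types f g h : 'rV[R]_n -> R.
Local Notation mu := (lebesgue_rV n).
Local Notation in_L2 := (in_L2 Omega).
Local Notation inner := (inner Omega).

Lemma in_L2_dominated f g : measurable_fun Omega f -> in_L2 g ->
  (forall x, Omega x -> `|f x| <= `|g x|) -> in_L2 f.
Proof.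
move=> mf [mg ig] fg; split => //.
apply: le_integrable ig => //.
  by apply/measurable_EFinP; exact: measurable_funX.
move=> x Ox /=; rewrite lee_fin !ger0_norm ?sqr_ge0//.
by rewrite -[f x ^+ 2]real_normK ?num_real// -[g x ^+ 2]real_normK ?num_real//
  lerXn2r ?nnegrE ?fg.
Qed.

Lemma in_L2_mul_integrable f g : in_L2 f -> in_L2 g ->
  mu.-integrable Omega (EFin \o (fun x => f x * g x)).
Proof.
move=> [mf if_] [mg ig].
have := integrableD mOmega if_ ig; apply: le_integrable => //.
  by apply/measurable_EFinP; exact: measurable_funM.
move=> x Ox /=; rewrite lee_fin.
rewrite [leRHS]ger0_norm ?addr_ge0 ?sqr_ge0// ler_norml.
by have := sqr_ge0 (f x + g x); have := sqr_ge0 (f x - g x); nra.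
Qed.

Lemma in_L2D f g : in_L2 f -> in_L2 g -> in_L2 (fun x => f x + g x).
Proof.
move=> Lf Lg; have [mf if_] := Lf; have [mg ig] := Lg.
split; first exact: measurable_funD.
have iM := in_L2_mul_integrable Lf Lg.
have i2 := integrableD mOmega if_ (integrableD mOmega ig (integrableD mOmega iM iM)).
apply: eq_integrable i2 => // x _ /=.
by rewrite -!EFinD; congr EFin; ring.
Qed.

Lemma in_L2Z a f : in_L2 f -> in_L2 (fun x => a * f x).
Proof.
move=> [mf if_]; split; first exact: measurable_funM.
apply: eq_integrable (integrableZl mOmega (a ^+ 2) if_) => // x _ /=.
by rewrite exprMn.
Qed.

Lemma in_L2N f : in_L2 f -> in_L2 (fun x => - f x).
Proof.
by move=> /(in_L2Z (-1)); under [in X in X -> _]eq_fun do rewrite mulN1r.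
Qed.

Lemma in_L2B f g : in_L2 f -> in_L2 g -> in_L2 (fun x => f x - g x).
Proof. by move=> Lf Lg; apply: in_L2D => //; exact: in_L2N. Qed.

Lemma in_L2_0 : in_L2 (fun=> 0).
Proof.
split; first exact: measurable_cst.
apply: eq_integrable (integrable0 _ _) => // x _.
by rewrite expr0n.
Qed.

Lemma in_L2_sum N (f : 'I_N -> 'rV[R]_n -> R) : (forall j, in_L2 (f j)) ->
  in_L2 (fun x => \sum_(j < N) f j x).
Proof.
elim: N f => [|N IH] f Lf.
  by under eq_fun do rewrite big_ord0; exact: in_L2_0.
under eq_fun do rewrite big_ord_recr/=.
by apply: in_L2D => //; exact: IH.
Qed.

Lemma innerC f g : inner f g = inner g f.
Proof. by apply: eq_Rintegral => x _; rewrite mulrC. Qed.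

Lemma innerDl f g h : in_L2 f -> in_L2 g -> in_L2 h ->
  inner (fun x => f x + g x) h = inner f h + inner g h.
Proof.
move=> Lf Lg Lh; rewrite /Defs.inner -RintegralD//; last 2 first.
- exact: in_L2_mul_integrable.
- exact: in_L2_mul_integrable.
by apply: eq_Rintegral => x _; rewrite mulrDl.
Qed.

Lemma innerZl a f g : in_L2 f -> in_L2 g ->
  inner (fun x => a * f x) g = a * inner f g.
Proof.
move=> Lf Lg; rewrite /Defs.inner -RintegralZl//; last exact: in_L2_mul_integrable.
by apply: eq_Rintegral => x _; rewrite mulrA.
Qed.

Lemma innerDr f g h : in_L2 f -> in_L2 g -> in_L2 h ->
  inner h (fun x => f x + g x) = inner h f + inner h g.
Proof. by move=> Lf Lg Lh; rewrite innerC innerDl// !(innerC h). Qed.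

Lemma innerZr a f g : in_L2 f -> in_L2 g ->
  inner g (fun x => a * f x) = a * inner g f.
Proof. by move=> Lf Lg; rewrite innerC innerZl// innerC. Qed.

Lemma innerBl f g h : in_L2 f -> in_L2 g -> in_L2 h ->
  inner (fun x => f x - g x) h = inner f h - inner g h.
Proof.
move=> Lf Lg Lh; rewrite innerDl//; last exact: in_L2N.
congr (_ + _); rewrite -mulN1r -innerZl//.
by apply: eq_Rintegral => x _; rewrite mulN1r.
Qed.

Lemma innerBr f g h : in_L2 f -> in_L2 g -> in_L2 h ->
  inner h (fun x => f x - g x) = inner h f - inner h g.
Proof. by move=> Lf Lg Lh; rewrite innerC innerBl// !(innerC h). Qed.

Lemma inner0l f : inner (fun=> 0) f = 0.
Proof.
by rewrite /Defs.inner; under eq_Rintegral do rewrite mul0r; rewrite Rintegral_cst ?mul0r.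
Qed.

Lemma inner_suml N (f : 'I_N -> 'rV[R]_n -> R) g :
  (forall j, in_L2 (f j)) -> in_L2 g ->
  inner (fun x => \sum_(j < N) f j x) g = \sum_(j < N) inner (f j) g.
Proof.
move=> + Lg; elim: N f => [|N IH] f Lf.
  by rewrite big_ord0; under eq_fun do rewrite big_ord0; exact: inner0l.
under eq_fun do rewrite big_ord_recr/=.
rewrite big_ord_recr/= innerDl//; first by rewrite IH.
exact: in_L2_sum.
Qed.

Lemma inner_ge0 f : 0 <= inner f f.
Proof. by apply: Rintegral_ge0 => x _; rewrite -expr2 sqr_ge0. Qed.

Lemma le_inner_sqr f g : in_L2 f -> in_L2 g ->
  (forall x, Omega x -> `|f x| <= `|g x|) -> inner f f <= inner g g.
Proof.
move=> Lf Lg fg; apply: le_Rintegral => //; try exact: in_L2_mul_integrable.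
move=> x Ox /=; rewrite -!expr2.
by rewrite -[f x ^+ 2]real_normK ?num_real// -[g x ^+ 2]real_normK ?num_real//
  lerXn2r ?nnegrE ?fg.
Qed.

Lemma inner_sqrE f : in_L2 f ->
  (\int[mu]_(x in Omega) (f x ^+ 2)%:E)%E = (inner f f)%:E.
Proof.
move=> [mf if_]; rewrite /Defs.inner /Rintegral fineK; last first.
  by under eq_integral do rewrite -expr2; exact: integrable_fin_num.
by apply: eq_integral => x _; rewrite expr2.
Qed.

Lemma inner_sqrB f g : in_L2 f -> in_L2 g ->
  inner (fun x => f x - g x) (fun x => f x - g x)
  = inner f f - 2 * inner f g + inner g g.
Proof.
move=> Lf Lg; have LB := in_L2B Lf Lg.
by rewrite innerBl// !innerBr// (innerC g f); ring.
Qed.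

Lemma inner_sqrD f g : in_L2 f -> in_L2 g ->
  inner (fun x => f x + g x) (fun x => f x + g x)
  = inner f f + 2 * inner f g + inner g g.
Proof.
move=> Lf Lg; have LB := in_L2D Lf Lg.
by rewrite innerDl// !innerDr// (innerC g f); ring.
Qed.

(** The quadratic polynomial t |-> || f - t g ||^2 is nonnegative. When || g || = 0
    it is affine, and the test value of t shows that it is constant. *)
Lemma cauchy_schwarz_inner f g : in_L2 f -> in_L2 g ->
  inner f g ^+ 2 <= inner f f * inner g g.
Proof.
move=> Lf Lg.
have H t : 0 <= inner f f - 2 * t * inner f g + t ^+ 2 * inner g g.
  have := inner_ge0 (fun x => f x - t * g x).
  rewrite inner_sqrB//; last exact: in_L2Z.
  have Ltg := in_L2Z t Lg.
  by rewrite innerZr// innerZl// innerZr//; lra.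
have := inner_ge0 g; rewrite le_eqVlt => /predU1P[gg0|gg0].
  rewrite -gg0 mulr0 in H *.
  have [->|fg0] := eqVneq (inner f g) 0; first by rewrite expr0n.
  have := H ((inner f f + 1) / (2 * inner f g)).
  rewrite (_ : 2 * _ * _ = inner f f + 1); last by field.
  by rewrite mulr0; lra.
have := H (inner f g / inner g g).
rewrite (_ : _ + _ = inner f f - inner f g ^+ 2 / inner g g); last first.
  by field; rewrite gt_eqF.
by rewrite subr_ge0 ler_pdivrMr.
Qed.

(** Convergence in mean square of square integrable functions, as a statement
    on real numbers. *)
Definition L2cvg (F : nat -> 'rV[R]_n -> R) f : Prop :=
  [/\ forall m, in_L2 (F m), in_L2 f &
      inner (fun x => F m x - f x) (fun x => F m x - f x) @[m --> \oo] --> 0].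

Lemma cvg_L2P F f : (forall m, in_L2 (F m)) -> in_L2 f ->
  cvg_L2 Omega F f -> L2cvg F f.
Proof.
move=> LF Lf cF; split => //.
rewrite /cvg_L2 in cF.
rewrite (_ : (fun N => _) = fun N =>
  (inner (fun x => F N x - f x) (fun x => F N x - f x))%:E) in cF; last first.
  by apply/funext => N; rewrite inner_sqrE//; exact: in_L2B.
by case/fine_cvgP: cF.
Qed.

(** A function at finite distance from a square integrable one is square
    integrable. This gives access to approximating sequences whose own
    integrability is not part of the data. *)
Lemma cvg_L2_in_L2 F f : (forall m, measurable_fun Omega (F m)) -> in_L2 f ->
  cvg_L2 Omega F f -> \forall m \near \oo, in_L2 (F m).
Proof.
move=> mF Lf cF.
have : \forall m \near \oo,
    (\int[mu]_(x in Omega) ((F m x - f x) ^+ 2)%:E < 1)%E.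
  have : nbhs (0%E : \bar R) [set y | (y < 1)%E].
    by apply: open_nbhs_nbhs; split; [exact: open_ereal_lt_ereal|rewrite /= lte01].
  by move=> /cF.
apply: filterS => m Fm.
have LB : in_L2 (fun x => F m x - f x).
  have mB : measurable_fun Omega (fun x => F m x - f x).
    by apply: measurable_funB => //; case: Lf.
  split=> //; apply/integrableP; split.
    by apply/measurable_EFinP; exact: measurable_funX.
  under eq_integral do rewrite gee0_abs ?lee_fin ?sqr_ge0//.
  by rewrite (lt_trans Fm)// ltry.
rewrite (_ : F m = fun x => (F m x - f x) + f x); first exact: in_L2D.
by apply/funext => x; rewrite subrK.
Qed.

Lemma L2cvgD F f G g : L2cvg F f -> L2cvg G g ->
  L2cvg (fun m x => F m x + G m x) (fun x => f x + g x).
Proof.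
move=> [LF Lf cF] [LG Lg cG]; split; [by move=> m; exact: in_L2D|exact: in_L2D|].
apply: (@squeeze_cvgr _ _ _ _ (fun=> 0) (fun m =>
    2 * inner (fun x => F m x - f x) (fun x => F m x - f x) +
    2 * inner (fun x => G m x - g x) (fun x => G m x - g x))); last 2 first.
- exact: cvg_cst.
- rewrite [X in _ --> X](_ : 0 = 2 * 0 + 2 * 0); last by rewrite mulr0 addr0.
  by apply: cvgD; apply: cvgMl_tmp.
apply: nearW => m; rewrite inner_ge0/=.
have LFf := in_L2B (LF m) Lf; have LGg := in_L2B (LG m) Lg.
rewrite (_ : (fun x => F m x + G m x - _) =
  (fun x => (F m x - f x) + (G m x - g x))); last by apply/funext => x; ring.
have := inner_ge0 (fun x => (F m x - f x) - (G m x - g x)).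
by rewrite (inner_sqrD LFf LGg) (inner_sqrB LFf LGg); lra.
Qed.

Lemma L2cvgZ a F f : L2cvg F f ->
  L2cvg (fun m x => a * F m x) (fun x => a * f x).
Proof.
move=> [LF Lf cF]; split; [by move=> m; exact: in_L2Z|exact: in_L2Z|].
rewrite [X in _ --> X](_ : 0 = a ^+ 2 * 0); last by rewrite mulr0.
under eq_fun => m.
  rewrite (_ : (fun x => a * F m x - _) = (fun x => a * (F m x - f x))); last first.
    by apply/funext => x; ring.
  have LFf := in_L2B (LF m) Lf; have LaFf := in_L2Z a LFf.
  rewrite innerZl// innerZr// mulrA -expr2; over.
exact: cvgMl_tmp.
Qed.

Lemma L2cvg_cst f : in_L2 f -> L2cvg (fun=> f) f.
Proof.
move=> Lf; split => //; under eq_fun do under eq_fun do rewrite subrr.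
by rewrite inner0l; exact: cvg_cst.
Qed.

Lemma L2cvg_sum N (F : 'I_N -> nat -> 'rV[R]_n -> R) (f : 'I_N -> 'rV[R]_n -> R) :
  (forall j, L2cvg (F j) (f j)) ->
  L2cvg (fun m x => \sum_(j < N) F j m x) (fun x => \sum_(j < N) f j x).
Proof.
elim: N F f => [|N IH] F f Ff.
  under eq_fun do under eq_fun do rewrite big_ord0.
  under [X in L2cvg _ X]eq_fun do rewrite big_ord0.
  exact: L2cvg_cst in_L2_0.
under eq_fun do under eq_fun do rewrite big_ord_recr/=.
under [X in L2cvg _ X]eq_fun do rewrite big_ord_recr/=.
by apply: L2cvgD => //; exact: IH.
Qed.

Lemma L2cvg_inner F f h : L2cvg F f -> in_L2 h ->
  inner (F m) h @[m --> \oo] --> inner f h.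
Proof.
move=> [LF Lf cF] Lh; apply/subr_cvg0.
rewrite -norm_cvg0P/=.
have cS : Num.sqrt (inner (fun x => F m x - f x) (fun x => F m x - f x)
    * inner h h) @[m --> \oo] --> 0.
  rewrite -[X in _ --> X]sqrtr0; apply: continuous_cvg; first exact: sqrt_continuous.
  rewrite [X in _ --> X](_ : 0 = 0 * inner h h); last by rewrite mul0r.
  exact: cvgMr_tmp.
apply: (@squeeze_cvgr _ _ _ _ (fun=> 0) _ _ _ _ _ cS); last exact: cvg_cst.
apply: nearW => m; rewrite normr_ge0/= -innerBl// -sqrtr_sqr.
by rewrite ler_wsqrtr// cauchy_schwarz_inner//; exact: in_L2B.
Qed.

Lemma L2cvg_inner_sqr F f : L2cvg F f ->
  inner (F m) (F m) @[m --> \oo] --> inner f f.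
Proof.
move=> Ff; have [LF Lf cF] := Ff.
have cFf := L2cvg_inner Ff Lf.
rewrite [X in _ --> X](_ : _ = 0 + 2 * inner f f - inner f f); last by ring.
rewrite (_ : (fun m => _) = fun m =>
  inner (fun x => F m x - f x) (fun x => F m x - f x) +
    2 * inner (F m) f - inner f f); last first.
  by apply/funext => m; rewrite inner_sqrB//; ring.
by apply: cvgB; [apply: cvgD => //; exact: cvgMl_tmp|exact: cvg_cst].
Qed.

End L2.

(** * A smooth truncation *)

Section trunc.
Context {R : realType} (a e : R).

(** [soft_abs] smooths |y - a|, [inv_soft_abs] is its reciprocal, in terms of
    which the derivatives of all orders are polynomial, and [soft_max] smooths
    max (y, a) = (y + a + |y - a|) / 2, the additive constant being adjusted so
    that 0 is sent to 0. *)
Definition soft_abs (y : R) : R := Num.sqrt ((y - a) ^+ 2 + e ^+ 2).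
Definition inv_soft_abs (y : R) : R := (soft_abs y)^-1.
Definition soft_max (y : R) : R := (y + soft_abs y - soft_abs 0) / 2.

Hypothesis e_gt0 : 0 < e.

Lemma soft_abs_sqr y : soft_abs y ^+ 2 = (y - a) ^+ 2 + e ^+ 2.
Proof. by rewrite /soft_abs sqr_sqrtr// addr_ge0 ?sqr_ge0. Qed.

Lemma soft_abs_gt0 y : 0 < soft_abs y.
Proof. by rewrite sqrtr_gt0 ltr_wpDl ?sqr_ge0// exprn_gt0. Qed.

Lemma soft_absE y : soft_abs y = ((y - a) ^+ 2 + e ^+ 2) * inv_soft_abs y.
Proof. by rewrite -soft_abs_sqr expr2 mulfK// gt_eqF// soft_abs_gt0. Qed.

Lemma ler_soft_abs y : `|y - a| <= soft_abs y <= `|y - a| + e.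
Proof.
have S0 := soft_abs_gt0 y; have SE := soft_abs_sqr y.
have N0 := normr_ge0 (y - a); have NE := real_normK (num_real (y - a)).
apply/andP; split.
- by rewrite -(@ler_pXn2r _ 2)// ?nnegrE ?(ltW S0)// SE NE lerDl sqr_ge0.
- rewrite -(@ler_pXn2r _ 2)// ?nnegrE ?(ltW S0) ?addr_ge0 ?(ltW e_gt0)// SE -NE sqrrD.
  by have := mulr_ge0 N0 (ltW e_gt0); rewrite -mulr_natr; lra.
Qed.

Lemma is_derive_soft_abs (y : R) :
  is_derive y 1 soft_abs ((y - a) * inv_soft_abs y).
Proof.
have := soft_abs_gt0 y; rewrite sqrtr_gt0 => S0.
have H : is_derive y 1 (fun y : R => (y - a) ^+ 2 + e ^+ 2) (2 * (y - a)).
  rewrite (_ : (fun _ => _) = (id - cst a) ^+ 2 + cst (e ^+ 2)); last first.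
    by apply/funext.
  apply: is_derive_eq.
  by rewrite /= expr1 addr0 subr0 [_ *: _]mulr1.
have Hc := @is_derive1_comp _ Num.sqrt (fun y => (y - a) ^+ 2 + e ^+ 2) y _ _
  (is_derive1_sqrt S0) H.
apply: (is_derive_eq Hc).
rewrite -/(soft_abs y) /inv_soft_abs.
by field; rewrite gt_eqF// soft_abs_gt0.
Qed.

Lemma is_derive_inv_soft_abs (y : R) :
  is_derive y 1 inv_soft_abs (- ((y - a) * inv_soft_abs y ^+ 3)).
Proof.
have S0 : soft_abs y != 0 by rewrite gt_eqF// soft_abs_gt0.
apply: (is_derive_eq (is_deriveV S0 (is_derive_soft_abs y))).
rewrite /inv_soft_abs [LHS](_ : _ = - soft_abs y ^- 2 * ((y - a) * (soft_abs y)^-1))//.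
by field.
Qed.

Lemma is_derive_soft_max (y : R) :
  is_derive y 1 soft_max ((1 + (y - a) * inv_soft_abs y) / 2).
Proof.
have H := is_derive_soft_abs y.
rewrite (_ : soft_max = 2^-1 \*: (id + soft_abs - cst (soft_abs 0))); last first.
  by apply/funext => z; rewrite /soft_max mulrC.
apply: is_derive_eq.
by rewrite subr0 [_ *: _]mulrC.
Qed.

Lemma soft_max_slope_le1 y : `|(1 + (y - a) * inv_soft_abs y) / 2| <= 1.
Proof.
have S0 := soft_abs_gt0 y; have /andP[+ _] := ler_soft_abs y.
rewrite ler_norml => /andP[h1 h2].
have : -1 <= (y - a) * inv_soft_abs y <= 1.
  by rewrite ler_pdivlMr// ler_pdivrMr// mulN1r mul1r h1.
by rewrite ler_norml => /andP[? ?]; lra.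
Qed.

Lemma soft_max0 : soft_max 0 = 0.
Proof. by rewrite /soft_max; ring. Qed.

Let factor y :
  (soft_abs y - soft_abs 0) * (soft_abs y + soft_abs 0) = y * (y - a - a).
Proof.
by rewrite -subr_sqr !soft_abs_sqr; ring.
Qed.

Lemma ler_norm_soft_max y : `|soft_max y| <= `|y|.
Proof.
have S0 := soft_abs_gt0 0; have Sy := soft_abs_gt0 y.
have /andP[h0 _] := ler_soft_abs 0; have /andP[hy _] := ler_soft_abs y.
have h : `|soft_abs y - soft_abs 0| <= `|y|.
  rewrite -(@ler_pM2r _ (soft_abs y + soft_abs 0)) ?addr_gt0//.
  rewrite -[X in _ * X <= _]gtr0_norm ?addr_gt0// -normrM factor normrM.
  rewrite ler_wpM2l// (le_trans (ler_normB _ _))// lerD//.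
  by move: h0; rewrite sub0r normrN.
rewrite /soft_max normrM [X in _ * X]ger0_norm// ler_pdivrMr//.
rewrite -addrA (le_trans (ler_normD _ _))//; lra.
Qed.

(** The factor |y| makes the error, composed with a square integrable function,
    small in mean square. It comes from
      2 (soft_max y - max (y, a)) =
        (|y - a| - |a|) (|y - a| - soft_abs y + |a| - soft_abs 0)
        / (soft_abs y + soft_abs 0),
    where the middle factor is a sum of two errors lying in [- e, 0] and
    | |y - a| - |a| | <= |y|. *)
Lemma soft_max_max y : a < 0 -> `|soft_max y - Num.max y a| <= e / - a * `|y|.
Proof.
move=> a0; set b := - a; have b0 : 0 < b by rewrite oppr_gt0.
have S0 := soft_abs_gt0 0; have Sy := soft_abs_gt0 y.
have := ler_soft_abs 0; have := ler_soft_abs y.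
rewrite sub0r normrN (ltr0_norm a0) -/b => /andP[hy1 hy2] /andP[h01 h02].
set N := `|y - a| in hy1 hy2 *.
have Nb : `|N - b| <= `|y|.
  have -> : b = `|- a| by rewrite gtr0_norm.
  by apply: le_trans (ler_dist_dist _ _) _; rewrite opprK subrK.
have -> : soft_max y - Num.max y a =
    (N - b) * ((N - soft_abs y) + (b - soft_abs 0)) / (soft_abs y + soft_abs 0) / 2.
  have N2 : N ^+ 2 = (y - a) ^+ 2 by rewrite real_normK ?num_real.
  have -> : Num.max y a = (y + a + N) / 2.
    by rewrite /N; case: (lerP a y) => ay; field.
  have F := factor y.
  have S : soft_abs y + soft_abs 0 != 0 by rewrite gt_eqF// addr_gt0.
  have -> : soft_max y = (y + y * (y - a - a) / (soft_abs y + soft_abs 0)) / 2.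
    by rewrite -F mulfK//; rewrite /soft_max addrA.
  have -> : y * (y - a - a) = N ^+ 2 - b ^+ 2 by rewrite N2 /b; ring.
  by rewrite /b; field.
rewrite -!mulrA -invfM [leRHS]mulrA normrM mulrC ler_pM//.
have eZ : e <= e / b * (soft_abs y + soft_abs 0).
  rewrite mulrAC ler_pdivlMr// ler_pM2l// (le_trans h01)// lerDr.
  exact: ltW.
have Z2 : 0 < (soft_abs y + soft_abs 0) * 2 by rewrite mulr_gt0// addr_gt0.
by rewrite ler_norml ler_pdivlMr// ler_pdivrMr// mulNr mulrA; apply/andP; split; lra.
Qed.

End trunc.

(** * Smooth functions and test functions *)

Section smooth_functions.
Context {R : realType} {n : nat}.
Implicit Types f g psi : 'rV[R]_n -> R.

(** Directional derivability is enough for this chain rule: everything takes place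
    on the line through x with direction v. *)
Lemma derive_comp_dir (g : R -> R) (g' : R) f (x v : 'rV[R]_n) :
  derivable f x v -> is_derive (f x) 1 g g' ->
  is_derive x v (g \o f) (g' * 'D_v f x).
Proof.
move=> df dg; pose F := fun h : R => f (h *: v + x).
have F0 : F 0 = f x by rewrite /F scale0r add0r.
have dF : derivable F 0 1 by move/derivable1P : df.
have lineE (k : 'rV[R]_n -> R) : 'D_v k x = 'D_1 (fun h : R => k (h *: v + x)) 0.
  rewrite /derive (_ : (fun h : R => h^-1 *: ((k \o shift x) (h *: v) - k x)) =
    fun h : R => h^-1 *: (((fun h : R => k (h *: v + x)) \o shift 0) (h *: (1 : R)) -
                      k ((0 : R) *: v + x)))//.
  by apply/funext => h /=; rewrite addr0 scale0r add0r [_%:A]mulr1.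
have Hc : is_derive (0 : R) 1 (g \o F) (g' * 'D_1 F 0).
  by apply: is_derive1_comp; [rewrite F0|exact: derivableP].
apply: DeriveDef; first by apply/derivable1P; exact: (@ex_derive _ _ _ _ _ _ _ Hc).
by rewrite lineE (@derive_val _ _ _ _ _ _ _ Hc) lineE.
Qed.

(** The algebra of functions generated by a set B. If partial derivation maps the
    generators into the algebra, it maps the algebra into itself; this is how
    iterated partial derivatives of composites are handled, without a formula
    for them. *)
Inductive generated_algebra (B : set ('rV[R]_n -> R)) : ('rV[R]_n -> R) -> Prop :=
| gen_base f : B f -> generated_algebra B f
| gen_cst c : generated_algebra B (cst c)
| gen_add f g : generated_algebra B f -> generated_algebra B g ->
    generated_algebra B (f + g)
| gen_mul f g : generated_algebra B f -> generated_algebra B g ->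
    generated_algebra B (f * g).

Lemma smooth_generated (B : set ('rV[R]_n -> R)) :
  (forall f, B f -> continuous f /\ forall i,
    (forall x, derivable f x (delta_mx ord0 i)) /\
    generated_algebra B (pderiv i f)) ->
  forall f, generated_algebra B f -> smooth f.
Proof.
move=> HB.
have H f : generated_algebra B f -> continuous f /\ forall i,
    (forall x, derivable f x (delta_mx ord0 i)) /\
    generated_algebra B (pderiv i f).
  elim=> {f} [f /HB//|c|f g Gf [cf df] Gg [cg dg]|f g Gf [cf df] Gg [cg dg]].
  - split; first exact: cst_continuous.
    move=> i; split; first by move=> x; exact: derivable_cst.
    rewrite (_ : pderiv i _ = cst 0); first exact: gen_cst.
    by apply/funext => x; exact: derive_cst.
  - split; first by move=> x; exact: continuousD (cf x) (cg x).
    move=> i; have [dfi Gfi] := df i; have [dgi Ggi] := dg i.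
    split; first by move=> x; exact: derivableD.
    rewrite (_ : pderiv i _ = pderiv i f + pderiv i g); first exact: gen_add.
    by apply/funext => x; exact: deriveD.
  - split; first by move=> x; exact: continuousM (cf x) (cg x).
    move=> i; have [dfi Gfi] := df i; have [dgi Ggi] := dg i.
    split; first by move=> x; exact: derivableM.
    rewrite (_ : pderiv i _ = f * pderiv i g + g * pderiv i f).
      by apply: gen_add; exact: gen_mul.
    by apply/funext => x; exact: deriveM.
have G f s : generated_algebra B f -> generated_algebra B (foldr (@pderiv R n) f s).
  by move=> Gf; elim: s => [//|i s] /= /H[_ /(_ i)[]].
move=> f Gf s /=; have [c d] := H _ (G f s Gf).
by split => // i; have [] := d i.
Qed.

Lemma smooth_pderiv f i : smooth f -> smooth (pderiv i f).
Proof. by move=> sf s; have := sf (rcons s i); rewrite foldr_rcons. Qed.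

Lemma smooth_base f : smooth f -> continuous f /\ forall i,
  (forall x, derivable f x (delta_mx ord0 i)) /\ smooth (pderiv i f).
Proof.
move=> sf; have [/= c d] := sf [::]; split; first exact: c.
by move=> i; split; [exact: d|exact: smooth_pderiv].
Qed.

Lemma smooth_algebra f : generated_algebra (@smooth R n) f -> smooth f.
Proof.
apply: smooth_generated => g /smooth_base[c d]; split => // i.
by have [? ?] := d i; split => //; exact: gen_base.
Qed.

Variable Omega : set 'rV[R]_n.
Local Notation test_function := (test_function Omega).

Lemma test_function0 : test_function (cst 0).
Proof.
split; first by apply: smooth_algebra; exact: gen_cst.
by exists set0; split => //; exact: compact0.
Qed.

Lemma test_functionD f g : test_function f -> test_function g ->
  test_function (f + g).
Proof.
move=> [sf [K [cK KO f0]]] [sg [L [cL LO g0]]]; split.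
  by apply: smooth_algebra; apply: gen_add; exact: gen_base.
exists (K `|` L); split; [exact: compactU|by rewrite subUset|].
by move=> x /not_orP[/f0 fx /g0 gx]; rewrite /= fctE fx gx addr0.
Qed.

Lemma test_functionZ c f : test_function f -> test_function (cst c * f).
Proof.
move=> [sf [K [cK KO f0]]]; split.
  by apply: smooth_algebra; apply: gen_mul; [exact: gen_cst|exact: gen_base].
by exists K; split=> // x /f0 fx; rewrite fctE fx mulr0.
Qed.

Lemma test_function_sum N (c : 'I_N -> R) (f : 'I_N -> 'rV[R]_n -> R) :
  (forall j, test_function (f j)) ->
  test_function (fun x => \sum_(j < N) c j * f j x).
Proof.
elim: N c f => [|N IH] c f tf.
  by under eq_fun do rewrite big_ord0; exact: test_function0.
under eq_fun do rewrite big_ord_recr/=.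
apply: test_functionD (test_functionZ _ (tf _)).
exact: IH.
Qed.

Lemma pderiv_sum N (c : 'I_N -> R) (f : 'I_N -> 'rV[R]_n -> R) i :
  (forall j, smooth (f j)) ->
  pderiv i (fun x => \sum_(j < N) c j * f j x) =
  (fun x => \sum_(j < N) c j * pderiv i (f j) x).
Proof.
move=> sf; apply/funext => x; rewrite /pderiv.
have -> : (fun x => \sum_(j < N) c j * f j x) = \sum_(j < N) (c j \*: f j).
  by apply/funext => y; rewrite fct_sumE.
have d j : derivable (f j) x (delta_mx ord0 i).
  by have [_ /(_ i)[]] := smooth_base (sf j).
rewrite derive_sum => [|j]; last exact: derivableZ.
by apply: eq_bigr => j _; rewrite deriveZ.
Qed.

Lemma pderiv_soft_max a e psi i x : 0 < e -> smooth psi ->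
  pderiv i (soft_max a e \o psi) x =
  (1 + (psi x - a) * inv_soft_abs a e (psi x)) / 2 * pderiv i psi x.
Proof.
move=> e0 /smooth_base[_ /(_ i)[dpsi _]].
apply: derive_val; apply: derive_comp_dir => //.
exact: is_derive_soft_max.
Qed.

(** The algebra generated by the smooth functions and by r = inv_soft_abs o psi is
    stable under derivation since r' = - (psi - a) r^3 psi', and it contains
    soft_max o psi since soft_abs y = ((y - a)^2 + e^2) inv_soft_abs y. *)
Lemma test_function_soft_max a e psi : 0 < e ->
  test_function psi -> test_function (soft_max a e \o psi).
Proof.
move=> e0 [spsi [K [cK KO psi0]]]; split; last first.
  by exists K; split => // x /psi0 /= ->; exact: soft_max0.
pose r : 'rV[R]_n -> R := inv_soft_abs a e \o psi.
pose B : set ('rV[R]_n -> R) := [set f | smooth f \/ f = r].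
have Bs f : smooth f -> generated_algebra B f by move=> ?; apply: gen_base; left.
have Br : generated_algebra B r by apply: gen_base; right.
have dr y := is_derive_inv_soft_abs a e0 y.
apply: (@smooth_generated B) => [f [|->]|].
- move=> /smooth_base[c d]; split => // i; have [di si] := d i; split => //.
  exact: Bs.
- have [c d] := smooth_base spsi; split.
    move=> x; apply: continuous_comp; first exact: c.
    apply/differentiable_continuous/derivable1_diffP.
    exact: (@ex_derive _ _ _ _ _ _ _ (dr _)).
  move=> i; have [di si] := d i; have dc x := derive_comp_dir (di x) (dr (psi x)).
  split; first by move=> x; exact: (@ex_derive _ _ _ _ _ _ _ (dc x)).
  rewrite (_ : pderiv i r =
    cst (-1) * ((psi + cst (- a)) * (r * (r * r))) * pderiv i psi).
    apply: gen_mul; last exact: Bs.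
    apply: gen_mul; first exact: gen_cst.
    apply: gen_mul; last by do 2!apply: gen_mul => //.
    by apply: gen_add; [exact: Bs|exact: gen_cst].
  apply/funext => x; rewrite /pderiv (@derive_val _ _ _ _ _ _ _ (dc x)).
  by rewrite !fctE /r /=; ring.
rewrite (_ : soft_max a e \o psi = cst 2^-1 * (psi +
  ((psi + cst (- a)) * (psi + cst (- a)) + cst (e ^+ 2)) * r +
  cst (- soft_abs a e 0))).
  apply: gen_mul; first exact: gen_cst.
  apply: gen_add; last exact: gen_cst.
  apply: gen_add; first exact: Bs.
  apply: gen_mul => //.
  apply: gen_add; last exact: gen_cst.
  by apply: gen_mul; (apply: gen_add; [exact: Bs|exact: gen_cst]).
apply/funext => x; rewrite /= /soft_max mulrC; congr (_ * (_ + _ - _)).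
by rewrite soft_absE// expr2.
Qed.

End smooth_functions.

(** * Expansion in an orthonormal basis *)

Section orthonormal.
Context {R : realType} {n : nat} (Omega : set 'rV[R]_n).
Hypothesis mOmega : measurable Omega.
Variable phi : nat -> 'rV[R]_n -> R.
Hypothesis phi_basis : orthonormal_basis_L2 Omega phi.
Implicit Types f g h : 'rV[R]_n -> R.
Local Notation in_L2 := (in_L2 Omega).
Local Notation inner := (inner Omega).

Let Lphi j : in_L2 (phi j). Proof. by case: phi_basis. Qed.

Lemma in_L2_comb (c : nat -> R) N : in_L2 (fun x => \sum_(j < N) c j * phi j x).
Proof. by apply: in_L2_sum => // j; exact: in_L2Z. Qed.

Lemma inner_comb (c : nat -> R) N f : in_L2 f ->
  inner (fun x => \sum_(j < N) c j * phi j x) f = \sum_(j < N) c j * inner f (phi j).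
Proof.
move=> Lf; rewrite inner_suml//; last by move=> j; exact: in_L2Z.
by apply: eq_bigr => j _; rewrite innerZl// innerC.
Qed.

Lemma inner_comb_comb (c : nat -> R) N :
  inner (fun x => \sum_(j < N) c j * phi j x) (fun x => \sum_(j < N) c j * phi j x)
  = \sum_(j < N) c j ^+ 2.
Proof.
have [_ phi1 _] := phi_basis.
rewrite inner_comb; last exact: in_L2_comb.
apply: eq_bigr => j _; rewrite inner_comb// (bigD1 j)//= phi1 eqxx mulr1.
rewrite big1 ?addr0 ?expr2// => l lj; rewrite phi1.
by rewrite (_ : (j == l :> nat) = false) ?mulr0//; apply/negbTE; rewrite eq_sym.
Qed.

(** Pythagoras: the distance from f to a combination splits into the error on the
    first coefficients and the distance from f to their span. *)
Lemma inner_comb_sqrB (c : nat -> R) N f : in_L2 f ->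
  inner (fun x => \sum_(j < N) c j * phi j x - f x)
        (fun x => \sum_(j < N) c j * phi j x - f x)
  = \sum_(j < N) (c j - inner f (phi j)) ^+ 2 +
    (inner f f - \sum_(j < N) inner f (phi j) ^+ 2).
Proof.
move=> Lf; rewrite inner_sqrB//; last exact: in_L2_comb.
rewrite inner_comb_comb inner_comb//.
under [in RHS]eq_bigr do rewrite sqrrB.
rewrite !big_split/= sumrN sumrMnl -mulr_natl.
ring.
Qed.

Lemma parseval f : in_L2 f ->
  \sum_(j < N) inner f (phi j) ^+ 2 @[N --> \oo] --> inner f f.
Proof.
move=> Lf; have [_ _ /(_ _ Lf) cf] := phi_basis.
have /(L2cvg_inner_sqr mOmega) : L2cvg Omega
    (fun N x => \sum_(j < N) inner f (phi j) * phi j x) f.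
  by apply: cvg_L2P => // m; exact: (@in_L2_comb (fun j => inner f (phi j))).
by under eq_fun do rewrite (inner_comb_comb (fun j => inner f (phi j))).
Qed.

Lemma bessel f N : in_L2 f -> \sum_(j < N) inner f (phi j) ^+ 2 <= inner f f.
Proof.
move=> Lf.
have := inner_ge0 Omega (fun x => \sum_(j < N) inner f (phi j) * phi j x - f x).
rewrite (inner_comb_sqrB (fun j => inner f (phi j)))//.
by under eq_bigr do rewrite subrr expr0n; rewrite sumr_const mul0rn add0r subr_ge0.
Qed.

End orthonormal.

(** * Truncation of square integrable functions *)

Section soft_max_L2.
Context {R : realType} {n : nat} (Omega : set 'rV[R]_n).
Hypothesis mOmega : measurable Omega.
Implicit Types f g h : 'rV[R]_n -> R.
Local Notation in_L2 := (in_L2 Omega).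
Local Notation inner := (inner Omega).
Variable a : R.
Hypothesis a_lt0 : a < 0.

Lemma ler_norm_maxr (y : R) : `|Num.max y a| <= `|y|.
Proof.
case: (lerP a y) => // ya.
by rewrite !ltr0_norm ?(lt_trans ya)// lerN2 ltW.
Qed.

Lemma ler_dist_maxr (y z : R) : `|Num.max y a - Num.max z a| <= `|y - z|.
Proof.
have [h1 h2] : y - z <= `|y - z| /\ - (y - z) <= `|y - z|.
  by split; [exact: ler_norm|rewrite -normrN; exact: ler_norm].
rewrite ler_norml; move: h1 h2 (normr_ge0 (y - z)); set d := `|y - z|.
by case: (lerP a y) => ay; case: (lerP a z) => az h1 h2 h3; apply/andP; split; lra.
Qed.

Lemma in_L2_maxr f : in_L2 f -> in_L2 (fun x => Num.max (f x) a).
Proof.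
move=> Lf; apply: in_L2_dominated (Lf) _ => // [|x _]; last exact: ler_norm_maxr.
by case: Lf => mf _; exact: measurable_maxr.
Qed.

(** The smoothing parameter 1 / (m + 1) tends to 0 along the sequence, so one limit
    removes both approximations: that of f by F m, and that of the truncation by
    its smooth version. *)
Lemma L2cvg_soft_max F f : (forall m, measurable_fun Omega
    (soft_max a m.+1%:R^-1 \o F m)) -> L2cvg Omega F f ->
  L2cvg Omega (fun m => soft_max a m.+1%:R^-1 \o F m) (fun x => Num.max (f x) a).
Proof.
move=> mT Ff; have [LF Lf cF] := Ff.
have e0 m : 0 < m.+1%:R^-1 :> R by rewrite invr_gt0.
have LT m : in_L2 (soft_max a m.+1%:R^-1 \o F m).
  apply: in_L2_dominated (LF m) _ => // x _ /=.
  exact: ler_norm_soft_max.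
have Lnorm g : in_L2 g -> in_L2 (fun x => `|g x|).
  move=> Lg; apply: in_L2_dominated (Lg) _ => // [|x _]; last by rewrite normr_id.
  by case: Lg => mg _; exact: measurableT_comp.
have Lm := in_L2_maxr Lf.
split => //.
pose A m x := m.+1%:R^-1 / - a * `|F m x|.
pose B m x := `|F m x - f x|.
have LA m : in_L2 (A m) by apply: in_L2Z => //; exact: Lnorm.
have LB m : in_L2 (B m) by apply: Lnorm; exact: in_L2B.
have AE m : inner (A m) (A m) = (m.+1%:R^-1 / - a) ^+ 2 * inner (F m) (F m).
  rewrite innerZl//; last exact: Lnorm.
  rewrite innerZr//; [|exact: Lnorm..].
  rewrite mulrA -expr2; congr (_ * _); apply: eq_Rintegral => x _.
  by rewrite -normrM ger0_norm// -expr2 sqr_ge0.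
have BE m : inner (B m) (B m) = inner (fun x => F m x - f x) (fun x => F m x - f x).
  by apply: eq_Rintegral => x _; rewrite -normrM ger0_norm// -expr2 sqr_ge0.
apply: (@squeeze_cvgr _ _ _ _ (fun=> 0)
   (fun m => 2 * inner (A m) (A m) + 2 * inner (B m) (B m))); last 2 first.
- exact: cvg_cst.
- rewrite [X in _ --> X](_ : 0 = 2 * ((0 / - a) ^+ 2 * inner f f) + 2 * 0); last first.
    by rewrite mul0r expr0n/= mul0r mulr0 addr0.
  under eq_fun do rewrite AE BE.
  apply: cvgD; last exact: cvgMl_tmp.
  apply: cvgMl_tmp; apply: cvgM; last exact: L2cvg_inner_sqr.
  rewrite [X in _ --> X]expr2; under eq_fun do rewrite expr2.
  have c0 : m.+1%:R^-1 / - a @[m --> \oo] --> 0 / - a.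
    by apply: cvgMr_tmp; exact: cvg_harmonic.
  exact: cvgM.
apply: nearW => m; rewrite inner_ge0/=.
have LAB := in_L2D mOmega (LA m) (LB m).
apply: (@le_trans _ _ (inner (fun x => A m x + B m x) (fun x => A m x + B m x))).
  apply: le_inner_sqr => // [|x _]; first exact: (in_L2B mOmega (LT m) Lm).
  have -> : (soft_max a m.+1%:R^-1 \o F m) x - Num.max (f x) a =
      (soft_max a m.+1%:R^-1 (F m x) - Num.max (F m x) a)
      + (Num.max (F m x) a - Num.max (f x) a) by rewrite addrA subrK.
  rewrite (le_trans (ler_normD _ _))// [leRHS]ger0_norm; last first.
    by rewrite /A /B addr_ge0// mulr_ge0// divr_ge0 ?ltW// oppr_gt0.
  by rewrite lerD//; [exact: soft_max_max|exact: ler_dist_maxr].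
have := inner_ge0 Omega (fun x => A m x - B m x).
by rewrite (inner_sqrD mOmega (LA m) (LB m)) (inner_sqrB mOmega (LA m) (LB m)); lra.
Qed.

End soft_max_L2.

(** * The Dirichlet form under truncation *)

Section dirichlet_form.
Context {R : realType} {n : nat} (Omega : set 'rV[R]_n).
Hypothesis mOmega : measurable Omega.
Implicit Types f g h chi : 'rV[R]_n -> R.
Local Notation in_L2 := (in_L2 Omega).
Local Notation inner := (inner Omega).
Local Notation L2cvg := (L2cvg Omega).
Local Notation test_function := (test_function Omega).

Lemma test_function_measurable chi : test_function chi ->
  measurable_fun Omega chi /\ forall i, measurable_fun Omega (pderiv i chi).
Proof.
move=> [/smooth_base[c d] _]; split; first exact: continuous_rV_measurable_fun.
move=> i; have [_ /smooth_base[ci _]] := d i.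
exact: continuous_rV_measurable_fun.
Qed.

Lemma cvg_L2_shift N F f : cvg_L2 Omega F f ->
  cvg_L2 Omega (fun m => F (m + N)%N) f.
Proof.
set I := fun m => (\int[lebesgue_rV n]_(x in Omega) ((F m x - f x) ^+ 2)%:E)%E.
by move=> cF; have : I (m + N)%N @[m --> \oo] --> 0%E by rewrite (cvg_shiftn N I).
Qed.

Definition H10_approx f (G : 'I_n -> 'rV[R]_n -> R)
    (psi : nat -> 'rV[R]_n -> R) : Prop :=
  [/\ forall m, test_function (psi m), L2cvg psi f &
      forall i, L2cvg (fun m => pderiv i (psi m)) (G i)].

(** The approximating sequence of [in_H10], with an initial segment dropped, so that
    every term and every partial derivative is square integrable. *)
Lemma in_H10_approx f G : in_H10 Omega f G -> exists psi, H10_approx f G psi.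
Proof.
move=> [Lf LG [psi [tpsi cpsi cGpsi]]].
have mpsi m := test_function_measurable (tpsi m).
have L1 := cvg_L2_in_L2 mOmega (fun m => (mpsi m).1) Lf cpsi.
have L2 : \forall m \near \oo, forall i, in_L2 (pderiv i (psi m)).
  apply: filter_forall => i.
  exact: (cvg_L2_in_L2 mOmega (fun m => (mpsi m).2 i) (LG i) (cGpsi i)).
have [N _ HN] := filterI L1 L2.
exists (fun m => psi (m + N)%N); split.
- by move=> m; exact: tpsi.
- by apply: cvg_L2P => // [m|]; [have [] := HN (m + N)%N (leq_addl _ _)|exact: cvg_L2_shift].
- move=> i; apply: cvg_L2P => // [m|].
    by have [_ ] := HN (m + N)%N (leq_addl _ _).
  exact: (cvg_L2_shift N (cGpsi i)).
Qed.

Variables (lambda : nat -> R) (phi : nat -> 'rV[R]_n -> R)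
  (G : nat -> 'I_n -> 'rV[R]_n -> R).
Hypothesis phi_basis : orthonormal_basis_L2 Omega phi.
Hypothesis phi_H10 : forall j, in_H10 Omega (phi j) (G j).
Hypothesis phi_eigen : forall j psi, test_function psi ->
  \sum_(i < n) inner (G j i) (pderiv i psi) = lambda j * inner (phi j) psi.

Let Lphi j : in_L2 (phi j). Proof. by case: phi_basis. Qed.
Let LG j i : in_L2 (G j i). Proof. by case: (phi_H10 j). Qed.

(** The weak equation for phi j, tested with test functions converging to phi l in
    H^1. *)
Lemma gradient_gram j l :
  \sum_(i < n) inner (G j i) (G l i) = lambda j * (j == l)%:R.
Proof.
have [psi [tpsi cpsi cGpsi]] := in_H10_approx (phi_H10 l).
have [_ phi1 _] := phi_basis.
have c1 : \sum_(i < n) inner (pderiv i (psi m)) (G j i) @[m --> \oo] -->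
    \sum_(i < n) inner (G l i) (G j i).
  by apply: cvg_big => [|i _]; [exact: add_continuous|exact: L2cvg_inner].
have c2 : lambda j * inner (psi m) (phi j) @[m --> \oo] -->
    lambda j * inner (phi l) (phi j).
  by apply: cvgMl_tmp; exact: L2cvg_inner.
under eq_bigr do rewrite innerC.
rewrite -phi1 (innerC _ (phi j)).
have E : (fun m => \sum_(i < n) inner (pderiv i (psi m)) (G j i)) =
    (fun m => lambda j * inner (psi m) (phi j)).
  apply/funext => m; rewrite (innerC _ (psi m)) -phi_eigen//.
  by apply: eq_bigr => i _; exact: innerC.
by rewrite E in c1; exact: (cvg_unique _ c1 c2).
Qed.

Lemma eigenvalue_ge0 j : 0 <= lambda j.
Proof.
rewrite -[lambda j]mulr1; have := gradient_gram j j; rewrite eqxx => <-.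
by apply: sumr_ge0 => i _; exact: inner_ge0.
Qed.

Definition grad_comb (c : nat -> R) N (i : 'I_n) x := \sum_(j < N) c j * G j i x.

Lemma in_L2_grad_comb c N i : in_L2 (grad_comb c N i).
Proof. by apply: in_L2_sum => // j; exact: in_L2Z. Qed.

Lemma inner_grad_comb c N i f : in_L2 f ->
  inner (grad_comb c N i) f = \sum_(j < N) c j * inner (G j i) f.
Proof.
move=> Lf; rewrite inner_suml//; last by move=> j; exact: in_L2Z.
by apply: eq_bigr => j _; rewrite innerZl.
Qed.

Lemma energy_comb c N :
  \sum_(i < n) inner (grad_comb c N i) (grad_comb c N i) =
  \sum_(j < N) lambda j * c j ^+ 2.
Proof.
transitivity (\sum_(i < n) \sum_(j < N) \sum_(l < N)
    c j * (c l * inner (G j i) (G l i))).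
  apply: eq_bigr => i _; rewrite inner_grad_comb; last exact: in_L2_grad_comb.
  apply: eq_bigr => j _; rewrite innerC inner_grad_comb// mulr_sumr.
  by apply: eq_bigr => l _; rewrite innerC.
rewrite exchange_big/=; apply: eq_bigr => j _.
rewrite exchange_big/= (bigD1 j)//= [X in _ + X]big1 => [|l lj].
  by rewrite addr0 -!mulr_sumr gradient_gram eqxx mulr1; ring.
rewrite -!mulr_sumr gradient_gram.
by rewrite (_ : (j == l :> nat) = false) ?mulr0//; apply/negbTE; rewrite eq_sym.
Qed.

(** Bessel's inequality for the gradients of the eigenfunctions: expand
    || grad (sum_j chi_j phi_j) - grad chi ||^2 >= 0. *)
Lemma energy_ge_spectral chi N : test_function chi -> in_L2 chi ->
  (forall i, in_L2 (pderiv i chi)) ->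
  \sum_(j < N) lambda j * inner chi (phi j) ^+ 2 <=
  \sum_(i < n) inner (pderiv i chi) (pderiv i chi).
Proof.
move=> tchi Lchi Ld; set c := fun j => inner chi (phi j).
have : 0 <= \sum_(i < n) inner (fun x => grad_comb c N i x - pderiv i chi x)
    (fun x => grad_comb c N i x - pderiv i chi x).
  by apply: sumr_ge0 => i _; exact: inner_ge0.
under eq_bigr => i _.
  rewrite (inner_sqrB mOmega (in_L2_grad_comb c N i) (Ld i)); over.
rewrite !big_split/= energy_comb sumrN -mulr_sumr.
have -> : \sum_(i < n) inner (grad_comb c N i) (pderiv i chi) =
    \sum_(j < N) lambda j * c j ^+ 2.
  under eq_bigr => i _ do rewrite inner_grad_comb//.
  rewrite exchange_big/=; apply: eq_bigr => j _.
  by rewrite -mulr_sumr phi_eigen// innerC /c; ring.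
by lra.
Qed.

Lemma comb_approx (c : nat -> R) N : exists psi,
  H10_approx (fun x => \sum_(j < N) c j * phi j x) (grad_comb c N) psi.
Proof.
have /choice[psi Hpsi] : forall j, exists psi, H10_approx (phi j) (G j) psi.
  by move=> j; exact: in_H10_approx.
exists (fun m x => \sum_(j < N) c j * psi j m x); split.
- by move=> m; apply: test_function_sum => j; have [] := Hpsi j.
- by apply: L2cvg_sum => // j; apply: L2cvgZ => //; have [] := Hpsi j.
- move=> i; under eq_fun => m.
    rewrite pderiv_sum; last by move=> j; have [/(_ m)[]] := Hpsi j.
    over.
  by apply: L2cvg_sum => // j; apply: L2cvgZ => //; have [_ _] := Hpsi j.
Qed.

(** The right-hand side is minimal at y = s x / (l + s), where equality holds. *)
Lemma yosida_le (l s x y : R) : 0 <= l -> 0 < s ->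
  l / (l + s) * x ^+ 2 <= s^-1 * (l * y ^+ 2) + (x - y) ^+ 2.
Proof.
move=> l0 s0; have ls : 0 < l + s by rewrite ltr_wpDl.
rewrite -subr_ge0 (_ : _ - _ = ((l + s) * y - s * x) ^+ 2 / (s * (l + s))).
  by rewrite divr_ge0 ?sqr_ge0// mulr_ge0// ltW.
by field; rewrite !gt_eqF.
Qed.

(** The form of the truncated f is at most s^-1 sum_j lambda_j chi_j^2 +
    || chi - max (f, a) ||^2 for every test function chi. Here chi runs through the
    smooth truncations of test functions psi m that converge in H^1 to
    v = sum_j c_j phi_j: the first term is at most s^-1 int |grad (psi m)|^2, and in
    the limit the second one is || max (v, a) - max (f, a) ||^2 <= || v - f ||^2. *)
Lemma yosida_maxr_comb (a s : R) f (c : nat -> R) N M : a < 0 -> 0 < s -> in_L2 f ->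
  \sum_(j < M) lambda j / (lambda j + s) *
    inner (fun x => Num.max (f x) a) (phi j) ^+ 2 <=
  s^-1 * (\sum_(j < N) lambda j * c j ^+ 2) +
  inner (fun x => \sum_(j < N) c j * phi j x - f x)
        (fun x => \sum_(j < N) c j * phi j x - f x).
Proof.
move=> a0 s0 Lf; set Tf := fun x => Num.max (f x) a.
have LTf : in_L2 Tf by exact: in_L2_maxr.
set v := fun x => \sum_(j < N) c j * phi j x.
have Lv : in_L2 v by exact: in_L2_comb.
have [psi [tpsi cpsi cdpsi]] := comb_approx c N.
have e0 m : 0 < m.+1%:R^-1 :> R by rewrite invr_gt0.
pose chi m := soft_max a m.+1%:R^-1 \o psi m.
have tchi m : test_function (chi m) by exact: test_function_soft_max.
have cchi : L2cvg chi (fun x => Num.max (v x) a).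
  by apply: L2cvg_soft_max => // m; have [] := test_function_measurable (tchi m).
have Lchi m : in_L2 (chi m) by case: cchi.
have Ldpsi m i : in_L2 (pderiv i (psi m)) by case: (cdpsi i).
have dchi m i x : `|pderiv i (chi m) x| <= `|pderiv i (psi m) x|.
  rewrite pderiv_soft_max//; last by case: (tpsi m).
  by rewrite normrM ler_piMl//; exact: soft_max_slope_le1.
have Ldchi m i : in_L2 (pderiv i (chi m)).
  apply: in_L2_dominated (Ldpsi m i) _ => //.
  by have [] := test_function_measurable (tchi m).
have bound m : \sum_(j < M) lambda j / (lambda j + s) * inner Tf (phi j) ^+ 2 <=
    s^-1 * (\sum_(i < n) inner (pderiv i (psi m)) (pderiv i (psi m))) +
    inner (fun x => chi m x - Tf x) (fun x => chi m x - Tf x).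
  apply: (@le_trans _ _ (\sum_(j < M) (s^-1 * (lambda j * inner (chi m) (phi j) ^+ 2)
      + inner (fun x => chi m x - Tf x) (phi j) ^+ 2))).
    apply: ler_sum => j _.
    apply: le_trans (yosida_le _ (inner (chi m) (phi j)) (eigenvalue_ge0 j) s0) _.
    by rewrite lerD2l innerBl// -[leLHS]sqrrN opprB.
  rewrite big_split/= -mulr_sumr lerD//; last first.
    by apply: bessel => //; exact: in_L2B.
  rewrite ler_pM2l ?invr_gt0//.
  apply: le_trans (energy_ge_spectral M (tchi m) (Lchi m) (Ldchi m)) _.
  by apply: ler_sum => i _; exact: le_inner_sqr.
have lim1 : s^-1 * (\sum_(i < n) inner (pderiv i (psi m)) (pderiv i (psi m))) +
    inner (fun x => chi m x - Tf x) (fun x => chi m x - Tf x) @[m --> \oo] -->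
    s^-1 * (\sum_(j < N) lambda j * c j ^+ 2) +
    inner (fun x => Num.max (v x) a - Tf x) (fun x => Num.max (v x) a - Tf x).
  apply: cvgD.
    apply: cvgMl_tmp; rewrite -energy_comb.
    apply: cvg_big => [|i _]; first exact: add_continuous.
    exact: L2cvg_inner_sqr.
  apply: L2cvg_inner_sqr => //.
  by apply: (L2cvgD mOmega cchi); apply: L2cvg_cst => //; exact: in_L2N.
apply: le_trans.
  by apply: (cvgr_to_ge lim1); exact: nearW.
rewrite lerD2l.
apply: le_inner_sqr => // [||x _].
- by apply: in_L2B => //; exact: in_L2_maxr.
- exact: in_L2B.
- exact: ler_dist_maxr.
Qed.

(** The choice c_j = s f_j / (lambda_j + s) minimizes the previous bound; the last
    bracket is the squared distance from f to the span of the first N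
    eigenfunctions. *)
Lemma yosida_maxr (a s : R) f N M : a < 0 -> 0 < s -> in_L2 f ->
  \sum_(j < M) lambda j / (lambda j + s) *
    inner (fun x => Num.max (f x) a) (phi j) ^+ 2 <=
  \sum_(j < N) lambda j / (lambda j + s) * inner f (phi j) ^+ 2 +
  (inner f f - \sum_(j < N) inner f (phi j) ^+ 2).
Proof.
move=> a0 s0 Lf; pose c j := s / (lambda j + s) * inner f (phi j).
apply: le_trans (yosida_maxr_comb c N M a0 s0 Lf) _.
rewrite inner_comb_sqrB// addrA lerD2r mulr_sumr -big_split/=.
rewrite le_eqVlt; apply/orP; left; apply/eqP; apply: eq_bigr => j _.
have ls : 0 < lambda j + s by rewrite ltr_wpDl ?eigenvalue_ge0.
by rewrite /c; field; rewrite !gt_eqF.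
Qed.

Lemma yosida_series_maxr (a s : R) f : a < 0 -> 0 < s -> in_L2 f ->
  (\sum_(0 <= j <oo) (lambda j / (lambda j + s) *
    inner (fun x => Num.max (f x) a) (phi j) ^+ 2)%:E <=
  \sum_(0 <= j <oo) (lambda j / (lambda j + s) * inner f (phi j) ^+ 2)%:E)%E.
Proof.
move=> a0 s0 Lf.
have w0 h j : 0 <= lambda j / (lambda j + s) * inner h (phi j) ^+ 2.
  by rewrite mulr_ge0 ?sqr_ge0// divr_ge0 ?addr_ge0 ?eigenvalue_ge0// ltW.
apply: lime_le.
  by apply: is_cvg_nneseries => j _ _; rewrite lee_fin.
apply: nearW => M; apply/lee_addgt0Pr => e e0.
have [N _ /(_ N (leqnn N)) HN] : \forall N \near \oo,
    inner f f - e < \sum_(j < N) inner f (phi j) ^+ 2.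
  have := parseval mOmega phi_basis Lf.
  by move=> /cvgr_gt; apply; rewrite ltrBlDr ltrDl.
rewrite sumEFin big_mkord.
have := yosida_maxr N M a0 s0 Lf => H.
apply: (@le_trans _ _ ((\sum_(j < N) lambda j / (lambda j + s) * inner f (phi j) ^+ 2)%:E + e%:E)%E).
  rewrite -EFinD lee_fin (le_trans H)// lerD2l.
  by rewrite lerBlDr -lerBlDl ltW.
rewrite leeD2r// -sumEFin -(big_mkord xpredT (fun j => (lambda j / (lambda j + s) * inner f (phi j) ^+ 2)%:E)).
by apply: nneseries_lim_ge => j _ _; rewrite lee_fin.
Qed.

End dirichlet_form.

(** * An integral representation of fractional powers *)

Section balakrishnan.
Context {R : realType} (alpha : R).
Hypothesis alpha01 : 0 < alpha < 1.
Local Notation mu := (@lebesgue_measure R).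

(** With the parameter s = exp y, a change of the scale of l becomes a translation of
    y, and the density is continuous on the whole line. *)
Definition yosida_density (l y : R) : R := expR (alpha * y) * (l / (l + expR y)).

Lemma yosida_density_ge0 l y : 0 <= l -> 0 <= yosida_density l y.
Proof.
by move=> l0; rewrite mulr_ge0 ?expR_ge0// divr_ge0// addr_ge0 ?expR_ge0.
Qed.

Lemma continuous_yosida_density l : 0 <= l -> continuous (yosida_density l).
Proof.
move=> l0 y; rewrite /continuous_at /yosida_density; apply: cvgM.
  apply: continuous_comp; last exact: continuous_expR.
  exact: mulrl_continuous.
apply: cvgMl_tmp; apply: cvgV; first by rewrite gt_eqF// ltr_wpDl// expR_gt0.
by apply: cvgD; [exact: cvg_cst|exact: continuous_expR].
Qed.

Lemma yosida_density_shift l y : 0 < l ->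
  yosida_density l (y + ln l) = l `^ alpha * yosida_density 1 y.
Proof.
move=> l0; rewrite /yosida_density mulrDr !expRD lnK ?posrE//.
rewrite /powR gt_eqF//.
have e0 : 0 < expR y by exact: expR_gt0.
by field; rewrite !gt_eqF// addr_gt0// mulr_gt0.
Qed.

(** The density decays like exp (alpha y) at - oo and like exp (- (1 - alpha) y) at
    + oo. *)
Lemma yosida_density1_le y :
  yosida_density 1 y <= expR (- (Num.min alpha (1 - alpha) * `|y|)).
Proof.
have /andP[a0 a1] := alpha01.
have e0 : 0 < expR y by exact: expR_gt0.
rewrite /yosida_density mul1r ler_pdivrMr; last by rewrite addr_gt0.
have m1 : Num.min alpha (1 - alpha) <= alpha by rewrite ge_min lexx.
have m2 : Num.min alpha (1 - alpha) <= 1 - alpha by rewrite ge_min lexx orbT.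
rewrite mulrDr mulr1 -expRD.
have [y0|y0] := leP 0 y.
  apply: ler_wpDl; first exact: expR_ge0.
  by rewrite ler_expR ger0_norm//; have := ler_wpM2r y0 m2; lra.
apply: ler_wpDr; first exact: expR_ge0.
by rewrite ler_expR ltr0_norm//; have := ler_wnM2r (ltW y0) m1; lra.
Qed.

Lemma integral_expR_abs_lty (b : R) : 0 < b ->
  (\int[mu]_y (expR (- (b * `|y|)))%:E < +oo)%E.
Proof.
move=> b0.
have cf : continuous (fun y : R => expR (- (b * `|y|))).
  move=> y; apply: continuous_comp; last exact: continuous_expR.
  apply: cvgN; apply: cvgMl_tmp.
  exact: norm_continuous.
rewrite (@ge0_symfun_integralT _ (fun y => expR (- (b * `|y|)))); last 3 first.
- by move=> y; exact: expR_ge0.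
- exact: cf.
- by move=> y /=; rewrite normrN.
rewrite -set_itvcy lte_mul_pinfty//.
have dF (x : R) : is_derive x 1 (fun y => - b^-1 * expR (- b * y)) (expR (- b * x)).
  have H : is_derive x 1 (fun y : R => - b * y) (- b).
    by apply: is_derive_eq; rewrite [_ *: _]mulr1.
  have Hc := @is_derive1_comp _ expR (fun y => - b * y) x _ _ (is_derive_expR _) H.
  apply: (is_derive_eq (is_deriveZ (- b^-1) Hc)).
  rewrite [LHS](_ : _ = - b^-1 * (expR (- b * x) * - b))//; field.
  by rewrite gt_eqF.
rewrite (@ge0_continuous_FTC2y _ _ (fun y => - b^-1 * expR (- b * y)) 0 0).
- by rewrite -EFinB ltry.
- by move=> x _; exact: expR_ge0.
- exact: continuous_subspaceT.
- rewrite [X in _ --> X](_ : 0 = - b^-1 * 0); last by rewrite mulr0.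
  apply: cvgMl_tmp.
  rewrite (_ : (fun x => _) = (fun z => expR (- z)) \o (fun x => b * x)); last first.
    by apply/funext => x /=; rewrite mulNr.
  apply: (@cvg_comp _ _ _ _ _ _ (pinfty_nbhs R)); last exact: cvgr_expR.
  exact: gt0_cvgMry.
- by move=> x _; exact: (@ex_derive _ _ _ _ _ _ _ (dF x)).
- apply: cvg_at_right_filter.
  have /derivable1_diffP := @ex_derive _ _ _ _ _ _ _ (dF 0).
  by move=> /differentiable_continuous.
- move=> x; rewrite in_itv/= andbT => x0.
  rewrite derive1E (@derive_val _ _ _ _ _ _ _ (dF x)).
  by rewrite gtr0_norm// mulNr.
Qed.

(** For l > 0 the translation by ln l reduces the integral to the case l = 1, at the
    price of the factor exp (alpha ln l) = l^alpha. *)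
Lemma integral_yosida_density : exists2 K : R, 0 < K &
  forall l, 0 <= l -> (\int[mu]_y (yosida_density l y)%:E = (K * l `^ alpha)%:E)%E.
Proof.
have /andP[a0 a1] := alpha01.
set I := (\int[mu]_y (yosida_density 1 y)%:E)%E.
have m1 := @continuous_measurable_fun _ _ (continuous_yosida_density ler01).
have Ige0 : (0 <= I)%E.
  by apply: integral_ge0 => y _; rewrite lee_fin yosida_density_ge0.
have Ioo : (I < +oo)%E.
  have b0 : 0 < Num.min alpha (1 - alpha) by rewrite lt_min a0 subr_gt0.
  apply: le_lt_trans (integral_expR_abs_lty b0).
  apply: ge0_le_integral => //=.
  - by move=> y _; rewrite lee_fin yosida_density_ge0.
  - exact/measurable_EFinP.
  - apply/measurable_EFinP; apply: measurableT_comp => //.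
    by apply: measurableT_comp => //; apply: measurable_funM.
  - by move=> y _; rewrite lee_fin; exact: yosida_density1_le.
have Igt0 : (0 < I)%E.
  apply: (@lt_le_trans _ _ (\int[mu]_(y in `[0%R, 1%R]) ((1 + expR 1)^-1)%:E)%E).
    rewrite integral_cst//= lebesgue_measure_itv/= lte_fin ltr01 -EFinB -EFinM.
    by rewrite lte_fin subr0 mulr1 invr_gt0 addr_gt0// expR_gt0.
  apply: (@le_trans _ _ (\int[mu]_(y in `[0%R, 1%R]) (yosida_density 1 y)%:E)%E).
    apply: ge0_le_integral => //=.
    - by apply/measurable_EFinP; exact: measurable_funTS.
    - move=> y; rewrite in_itv/= => /andP[y0 y1]; rewrite lee_fin.
      rewrite /yosida_density mul1r -[leLHS]mul1r ler_pM ?invr_ge0 ?addr_ge0 ?expR_ge0//.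
        by rewrite -expR0 ler_expR mulr_ge0// ltW.
      by rewrite lef_pV2 ?posrE ?addr_gt0 ?expR_gt0// lerD2l ler_expR.
  apply: ge0_subset_integral => //.
  - exact/measurable_EFinP.
  - by move=> y _; rewrite lee_fin yosida_density_ge0.
have IE : I = (fine I)%:E by rewrite fineK// ge0_fin_numE.
exists (fine I); first by rewrite -lte_fin -IE.
move=> l; rewrite le_eqVlt => /predU1P[<-|l0].
  rewrite powR0 ?gt_eqF// mulr0 integral0_eq// => y _.
  by rewrite /yosida_density mul0r mulr0.
have cl := continuous_yosida_density (ltW l0).
have dS (x : R) : is_derive x 1 (fun y : R => y + ln l) 1.
  by apply: is_derive_eq; rewrite addr0.
have dSE : (fun y : R => y + ln l)^`()%classic = cst 1.
  apply/funext => x; rewrite derive1E.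
  exact: (@derive_val _ _ _ _ _ _ _ (dS x)).
rewrite (@increasing_ge0_integration_by_substitutionT _ (fun y => y + ln l)).
- rewrite dSE [in RHS]mulrC [in RHS]EFinM -IE -ge0_integralZl_EFin ?powR_ge0//; last 2 first.
  + by move=> y _; rewrite lee_fin yosida_density_ge0.
  + exact/measurable_EFinP.
  apply: eq_integral => y _; rewrite -EFinM -yosida_density_shift//.
  by congr EFin; rewrite !fctE mulr1.
- by move=> x y; rewrite ltrD2r.
- by rewrite dSE => x; exact: cst_continuous.
- by rewrite dSE; exact: is_cvg_cst.
- by rewrite dSE; exact: is_cvg_cst.
- by move=> x; exact: (@ex_derive _ _ _ _ _ _ _ (dS x)).
- exact: cvg_addrr_Ny.
- exact: cvg_addrr.
- exact: cl.
- by move=> y; rewrite yosida_density_ge0// ltW.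
Qed.

End balakrishnan.

(** * The fractional energy under truncation *)

Section fractional_energy.
Context {R : realType} {n : nat} (Omega : set 'rV[R]_n).
Hypothesis mOmega : measurable Omega.
Variables (lambda : nat -> R) (phi : nat -> 'rV[R]_n -> R).
Hypothesis eigenbasis : dirichlet_eigenbasis Omega lambda phi.
Variable alpha : R.
Hypothesis alpha01 : 0 < alpha < 1.
Implicit Types f g : 'rV[R]_n -> R.
Local Notation inner := (inner Omega).
Local Notation in_L2 := (in_L2 Omega).

Let phi_basis : orthonormal_basis_L2 Omega phi. Proof. by case: eigenbasis. Qed.

Definition frac_energy f : \bar R :=
  (\sum_(0 <= j <oo) (lambda j `^ alpha * inner f (phi j) ^+ 2)%:E)%E.

Let gradients : exists G : nat -> 'I_n -> 'rV[R]_n -> R, forall j,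
  in_H10 Omega (phi j) (G j) /\ forall psi, test_function Omega psi ->
  \sum_(i < n) inner (G j i) (pderiv i psi) = lambda j * inner (phi j) psi.
Proof.
have /choice[G HG] : forall j, exists Gj : 'I_n -> 'rV[R]_n -> R,
    in_H10 Omega (phi j) Gj /\ forall psi, test_function Omega psi ->
    \sum_(i < n) inner (Gj i) (pderiv i psi) = lambda j * inner (phi j) psi.
  by move=> j; have [_] := eigenbasis.1 j.
by exists G.
Qed.

Lemma dirichlet_eigenvalue_ge0 j : 0 <= lambda j.
Proof.
have [G HG] := gradients.
exact: (eigenvalue_ge0 mOmega phi_basis (fun j => (HG j).1) (fun j => (HG j).2)).
Qed.

(** Multiply the inequality for the parameter s = exp y by exp (alpha y) and
    integrate over y; by Tonelli the integral acts term by term and turns the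
    weights into multiples of lambda_j^alpha. *)
Lemma frac_energy_maxr (a : R) f : a < 0 -> in_L2 f ->
  (frac_energy (fun x => Num.max (f x) a) <= frac_energy f)%E.
Proof.
move=> a0 Lf; have [G HG] := gradients.
have [K K0 HK] := integral_yosida_density alpha01.
have l0 := dirichlet_eigenvalue_ge0.
have mY l : 0 <= l -> measurable_fun [set: R] (yosida_density alpha l).
  by move=> ?; apply: continuous_measurable_fun; exact: continuous_yosida_density.
have energyE h : (K%:E * frac_energy h = \int[lebesgue_measure]_y
    \sum_(0 <= j <oo) (yosida_density alpha (lambda j) y * inner h (phi j) ^+ 2)%:E)%E.
  rewrite integral_nneseries//; last 2 first.
  - by move=> j; apply/measurable_EFinP; apply: measurable_funM => //; exact: mY.
  - by move=> j y _; rewrite lee_fin mulr_ge0 ?sqr_ge0// yosida_density_ge0.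
  rewrite /frac_energy -nneseriesZl; last first.
    by move=> j _; rewrite lee_fin mulr_ge0 ?powR_ge0 ?sqr_ge0.
  apply: eq_eseriesr => j _.
  under eq_integral do rewrite EFinM.
  rewrite ge0_integralZr//; last 3 first.
  - by apply/measurable_EFinP; exact: mY.
  - by move=> y _; rewrite lee_fin yosida_density_ge0.
  - by rewrite lee_fin sqr_ge0.
  by rewrite HK// -!EFinM mulrA.
rewrite -(@lee_pmul2l _ K%:E)// !energyE.
have mS h : measurable_fun [set: R] (fun y =>
    (\sum_(0 <= j <oo) (yosida_density alpha (lambda j) y * inner h (phi j) ^+ 2)%:E)%E).
  apply: ge0_emeasurable_sum => [j y _ _|j _].
    by rewrite lee_fin mulr_ge0 ?sqr_ge0// yosida_density_ge0.
  by apply/measurable_EFinP; apply: measurable_funM => //; exact: mY.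
have S0 h y : (0 <= \sum_(0 <= j <oo) (yosida_density alpha (lambda j) y * inner h (phi j) ^+ 2)%:E)%E.
  apply: nneseries_ge0 => j _ _.
  by rewrite lee_fin mulr_ge0 ?sqr_ge0// yosida_density_ge0.
apply: ge0_le_integral => //; [exact: mS|exact: mS|].
move=> y _.
have E h : (\sum_(0 <= j <oo) (yosida_density alpha (lambda j) y * inner h (phi j) ^+ 2)%:E =
    (expR (alpha * y))%:E * \sum_(0 <= j <oo)
      (lambda j / (lambda j + expR y) * inner h (phi j) ^+ 2)%:E)%E.
  rewrite -nneseriesZl; last first.
    move=> j _; rewrite lee_fin mulr_ge0 ?sqr_ge0//.
    by rewrite divr_ge0// addr_ge0// expR_ge0.
  by apply: eq_eseriesr => j _; rewrite -EFinM /yosida_density -!mulrA.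
rewrite !E lee_pmul2l// ?lte_fin ?expR_gt0//.
apply: (yosida_series_maxr mOmega phi_basis (fun j => (HG j).1)
  (fun j => (HG j).2)) => //.
exact: expR_gt0.
Qed.

(** p <= 1 + p^2 with p = lambda_j^alpha. *)
Lemma frac_energy_lty f : in_Hs Omega lambda phi (2 * alpha) f ->
  (frac_energy f < +oo)%E.
Proof.
move=> [Lf fS].
have l0 := dirichlet_eigenvalue_ge0.
have S0 j : (0 <= (lambda j `^ (2 * alpha) * inner f (phi j) ^+ 2)%:E)%E.
  by rewrite lee_fin mulr_ge0 ?powR_ge0 ?sqr_ge0.
apply: (@le_lt_trans _ _ ((inner f f)%:E + spectral_sum Omega lambda phi (2 * alpha) f)%E).
  apply: lime_le.
    apply: is_cvg_nneseries => j _ _.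
    by rewrite lee_fin mulr_ge0 ?powR_ge0 ?sqr_ge0.
  apply: nearW => N.
  apply: (@le_trans _ _ (\sum_(0 <= j < N) ((inner f (phi j) ^+ 2)%:E +
      (lambda j `^ (2 * alpha) * inner f (phi j) ^+ 2)%:E))%E).
    apply: lee_sum => j _; rewrite -EFinD lee_fin.
    rewrite -{2}[inner f (phi j) ^+ 2]mul1r -mulrDl ler_wpM2r ?sqr_ge0//.
    rewrite mulrC powRrM powR_mulrn ?powR_ge0//.
    by have := sqr_ge0 (lambda j `^ alpha - 1); have := powR_ge0 (lambda j) alpha; nra.
  rewrite big_split/= leeD//; last exact: nneseries_lim_ge.
  by rewrite sumEFin lee_fin big_mkord; exact: bessel.
by rewrite lte_add_pinfty ?ltry.
Qed.

(** If t_j are the coefficients of max (f, a), then 2 f_j (t_j - f_j) <= t_j^2 - f_j^2.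
    Hence the N-th partial sum of 2 <g, max (f, a) - f> is at most the energy of
    max (f, a) minus the N-th partial sum of the energy of f, and the former energy
    is at most the full energy of f. *)
Lemma inner_frac_laplacian_le0 (a : R) f g : a < 0 ->
  is_frac_laplacian Omega lambda phi alpha f g ->
  inner g (fun x => Num.max (f x) a - f x) <= 0.
Proof.
move=> a0 [Hf Lg cg]; have [Lf _] := Hf.
have LT : in_L2 (fun x => Num.max (f x) a) by exact: in_L2_maxr.
set psi := fun x => _; have Lpsi : in_L2 psi by exact: in_L2B.
have Lphi j : in_L2 (phi j) by case: phi_basis.
pose c j := lambda j `^ alpha * inner f (phi j).
have cS : L2cvg Omega (fun N x => \sum_(j < N) c j * phi j x) g.
  by apply: cvg_L2P => // N; exact: in_L2_comb.
have := L2cvg_inner mOmega cS Lpsi.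
under eq_fun do rewrite inner_comb//.
move=> cI.
pose Q N := \sum_(j < N) lambda j `^ alpha * inner f (phi j) ^+ 2.
have Efin : frac_energy f \is a fin_num.
  rewrite ge0_fin_numE; first exact: frac_energy_lty.
  by apply: nneseries_ge0 => j _ _; rewrite lee_fin mulr_ge0 ?powR_ge0 ?sqr_ge0.
have cQ : Q N @[N --> \oo] --> fine (frac_energy f).
  have : (\sum_(0 <= j < N) (lambda j `^ alpha * inner f (phi j) ^+ 2)%:E)%E
      @[N --> \oo] --> (fine (frac_energy f))%:E.
    rewrite fineK//; apply: is_cvg_nneseries => j _ _.
    by rewrite lee_fin mulr_ge0 ?powR_ge0 ?sqr_ge0.
  under eq_fun do rewrite sumEFin big_mkord.
  by move/fine_cvgP => [_].
have cD : 2^-1 * (fine (frac_energy f) - Q N) @[N --> \oo] --> 0.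
  rewrite [X in _ --> X](_ : 0 = 2^-1 * (fine (frac_energy f) - fine (frac_energy f))).
    by apply: cvgMl_tmp; apply: cvgB => //; exact: cvg_cst.
  by rewrite subrr mulr0.
apply: (ler_cvg_to cI cD); apply: nearW => N.
apply: (@le_trans _ _ (2^-1 * (\sum_(j < N) lambda j `^ alpha *
    inner (fun x => Num.max (f x) a) (phi j) ^+ 2 - Q N))).
  rewrite /Q -sumrB mulr_sumr; apply: ler_sum => j _.
  rewrite /psi innerBl// -mulrBr mulrCA /c -mulrA ler_wpM2l ?powR_ge0//.
  have := sqr_ge0 (inner (fun x => Num.max (f x) a) (phi j) - inner f (phi j)).
  by nra.
rewrite ler_pM2l ?invr_gt0// lerD2r -lee_fin fineK//.
apply: le_trans (frac_energy_maxr a0 Lf).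
rewrite -sumEFin -(big_mkord xpredT (fun j => (lambda j `^ alpha *
  inner (fun x => Num.max (f x) a) (phi j) ^+ 2)%:E)).
by apply: nneseries_lim_ge => j _ _; rewrite lee_fin mulr_ge0 ?powR_ge0 ?sqr_ge0.
Qed.

End fractional_energy.

(** * Derivatives at a minimum *)

Section minimum_point.
Context {R : realType}.

(** The difference quotients along v are nonnegative for h > 0 and nonpositive for
    h < 0. *)
Lemma derive_min (V : normedModType R) (f : V -> R) (U : set V) (x v : V) :
  open U -> U x -> (forall y, U y -> f x <= f y) -> derivable f x v ->
  'D_v f x = 0.
Proof.
move=> oU Ux fmin df.
have cq : h^-1 *: ((f \o shift x) (h *: v) - f x) @[h --> (0 : R)^'] --> 'D_v f x.
  exact: df.
have nU : \forall h \near (0 : R), U (h *: v + x).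
  have : h *: v + x @[h --> (0 : R)] --> x.
    rewrite -[X in _ --> X]add0r -[X in _ --> X + _](scale0r v).
    by apply: cvgD; [apply: cvgZr_tmp; exact: cvg_id|exact: cvg_cst].
  by apply; exact: open_nbhs_nbhs.
have pick (P : R -> Prop) : (\forall h \near (0 : R)^', P h) ->
    exists2 e, 0 < e & forall h, h != 0 -> `|h| < e -> P h /\ U (h *: v + x).
  move=> nP; have nU' : \forall h \near (0 : R)^', U (h *: v + x) by exact: cvg_within.
  have [e /= e0 He] := filterI nP nU'.
  by exists e => // h h0 he; apply: He => //=; rewrite sub0r normrN.
have [l0|l0|//] := ltgtP ('D_v f x) 0.
- have [e e0 He] := pick _ (cvgr_lt _ cq _ l0).
  have e20 : 0 < e / 2 by rewrite divr_gt0.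
  have [||+ /fmin] := He (e / 2); first by rewrite gt_eqF.
    by rewrite gtr0_norm// ltr_pdivrMr// ltr_pMr// ltr1n.
  rewrite /= => + fle; rewrite ltNge => /negP; case.
  by rewrite mulr_ge0 ?invr_ge0 ?subr_ge0// ltW.
- have [e e0 He] := pick _ (cvgr_gt _ cq _ l0).
  have e20 : 0 < e / 2 by rewrite divr_gt0.
  have [||+ /fmin] := He (- (e / 2)); first by rewrite oppr_eq0 gt_eqF.
    by rewrite normrN gtr0_norm// ltr_pdivrMr// ltr_pMr// ltr1n.
  rewrite /= => + fle; rewrite ltNge => /negP; case.
  by rewrite mulr_le0_ge0 ?invr_le0 ?subr_ge0// oppr_le0 ltW.
Qed.

(** Only earlier times t - eta are compared with t, so t = T is covered as well. The
    lower bound gives a difference quotient at most u (x, t) (1 - exp (- y)) / eta with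
    y = beta eta, and 1 - exp (- y) >= y / 2 when 0 < y <= 1. *)
Lemma dt_min n (T beta : R) (u : 'rV[R]_n * R -> R) (x : 'rV[R]_n) (t : R) :
  0 < beta -> 0 < t <= T -> cvg (dt_filter T u (x, t)) -> u (x, t) < 0 ->
  (forall s, 0 < s <= T -> expR (beta * (s - t)) * u (x, t) <= u (x, s)) ->
  dt T u (x, t) <= beta / 2 * u (x, t).
Proof.
move=> b0 /andP[t0 tT] cq mu0 umin; set m := u (x, t) in mu0 umin *.
rewrite leNgt; apply/negP => lt_dt.
have [e /= e0 He] : \forall s \near within [set s | 0 < s <= T] (dnbhs t),
    beta / 2 * m < (u (x, s) - m) / (s - t) by exact: (cvgr_gt _ cq _ lt_dt).
pose eta := Num.min (e / 2) (Num.min (t / 2) beta^-1).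
have eta0 : 0 < eta by rewrite !lt_min !divr_gt0 ?invr_gt0.
have [h1 h2 h3] : [/\ eta < e, eta < t & beta * eta <= 1].
  have i1 : eta <= e / 2 by rewrite ge_min lexx.
  have i2 : eta <= t / 2 by rewrite !ge_min lexx orbT.
  have i3 : eta <= beta^-1 by rewrite !ge_min lexx !orbT.
  split; [lra|lra|].
  by rewrite mulrC -ler_pdivlMr// mul1r.
have := He (t - eta).
rewrite /ball_/= opprB addrC subrK gtr0_norm// => /(_ h1).
have te : t - eta != t by rewrite lt_eqF// ltrBlDr ltrDl.
have te1 : 0 < t - eta <= T by rewrite subr_gt0 h2/=; lra.
move=> /(_ te te1); rewrite ltNge => /negP; apply.
have -> : t - eta - t = - eta by ring.
rewrite ler_ndivrMr ?oppr_lt0//.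
have := umin _ te1; rewrite (_ : t - eta - t = - eta); last by ring.
suff : beta / 2 * m * - eta <= expR (beta * - eta) * m - m by lra.
have -> : expR (beta * - eta) * m - m = (expR (- (beta * eta)) - 1) * m.
  by rewrite mulrN mulrBl mul1r.
rewrite (_ : _ * - eta = (- (beta * eta / 2)) * m); last by ring.
rewrite ler_nM2r// lerBlDr.
set y := beta * eta in h3 *; have y0 : 0 < y by rewrite mulr_gt0.
(* exp (- y) <= 1 / (1 + y) <= 1 - y / 2, the latter as y <= 1. *)
have E1 : 1 + y <= expR y by exact: expR_ge1Dx.
rewrite expRN -[leLHS]mul1r ler_pdivrMr ?expR_gt0//.
nra.
Qed.

End minimum_point.

(** * Continuity on subsets *)

Section restriction.
Context {R : realType}.

Lemma within_slice (V W : topologicalType) (A : set (V * W)) (D : set V) (t : W)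
    (f : V * W -> R) :
  {within A, continuous f} -> (forall x, D x -> A (x, t)) ->
  {within D, continuous (fun x => f (x, t))}.
Proof.
move=> /subspace_continuousP cf DA; apply/subspace_continuousP => x Dx.
have cx := cf (x, t) (DA x Dx).
apply: cvg_trans cx => P /= [[B C] /= [nB nC] HBC].
rewrite /within/=; apply: filterS nB => y By Dy.
by apply: (HBC (y, t)); [split => //; exact: nbhs_singleton|exact: DA].
Qed.

Lemma continuous_at_sum (V : topologicalType) N (f : 'I_N -> V -> R) (x : V) :
  (forall i, {for x, continuous (f i)}) ->
  {for x, continuous (fun y => \sum_(i < N) f i y)}.
Proof.
move=> cf; apply: cvg_big => [|i _]; first exact: add_continuous.
exact: cf.
Qed.

Lemma within_closure_ge0 (V : topologicalType) (A D : set V) (f : V -> R) p :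
  {within A, continuous f} -> A p -> D `<=` A -> closure D p ->
  (forall q, D q -> 0 <= f q) -> 0 <= f p.
Proof.
move=> /subspace_continuousP cf Ap DA Dp f0; rewrite leNgt; apply/negP => fp.
have : \forall q \near within A (nbhs p), f q < 0 by exact: (cvgr_lt _ (cf p Ap) _ fp).
rewrite /within/= => /Dp[q [Dq fq]].
by have := fq (DA _ Dq); rewrite ltNge f0.
Qed.

End restriction.

(** * The parabolic cylinder *)

Section parabolic_cylinder.
Context {R : realType} {n : nat} (Omega : set 'rV[R]_n.+1) (T : R).
Hypotheses (bOmega : bounded_set Omega) (T_gt0 : 0 < T).
Local Notation Q := (cylinder Omega T).
Local Notation CQ := (closure (cylinder Omega T)).

Lemma compact_closure_Omega : compact (closure Omega).
Proof.
apply: bounded_closed_compact; last exact: closed_closure.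
move: bOmega => [M [Mr HM]]; exists M; split => // y My.
have cb : closed [set x : 'rV[R]_n.+1 | `|x| <= y].
  rewrite (_ : [set x | _] = (fun x : 'rV[R]_n.+1 => `|x|) @^-1` [set z | z <= y])//.
  by apply: preimage_closed => [x _|]; [exact: norm_continuous|exact: closed_le].
move=> x /= cx.
have : closure [set x : 'rV[R]_n.+1 | `|x| <= y] x.
  by apply: closureS cx => z Oz; exact: HM.
by rewrite -(closure_id _).1.
Qed.

Lemma closure_cylinder p : CQ p <-> closure Omega p.1 /\ 0 <= p.2 <= T.
Proof.
case: p => x t /=; split=> [cp|[cx t0T]].
  have cO : closed (closure Omega `*` `[0, T]%classic).
    apply: compact_closed; first exact: norm_hausdorff.
    by apply: compact_setX; [exact: compact_closure_Omega|exact: segment_compact].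
  have : closure (closure Omega `*` `[0, T]%classic) (x, t).
    apply: closureS cp => -[y s] /= [Oy /andP[s0 sT]]; split => /=.
      exact: subset_closure.
    by rewrite in_itv/= ltW.
  by rewrite -(closure_id _).1// => -[/= ? ]; rewrite in_itv.
move=> P [[B C] /= [nB nC] HBC].
have [y [Oy By]] := cx _ nB.
have ct : closure [set s : R | 0 < s <= T] t.
  move: t0T => /andP[t0 tT].
  have [t1|t1] := eqVneq t 0; last by apply: subset_closure; rewrite /= lt_neqAle eq_sym t1 t0.
  move=> S /nbhs_ballP[e /= e0 eS].
  pose s := Num.min (e / 2) T.
  have s0 : 0 < s by rewrite lt_min divr_gt0.
  have se : s <= e / 2 by rewrite ge_min lexx.
  exists s; split; first by rewrite /= s0 ge_min lexx orbT.
  apply: eS; rewrite /ball/= t1 sub0r normrN gtr0_norm//; lra.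
have [s [s0T Cs]] := ct _ nC.
by exists (y, s); split; [split|apply: HBC].
Qed.

Lemma compact_closure_cylinder : compact CQ.
Proof.
apply: (@subclosed_compact _ _ (closure Omega `*` `[0, T]%classic)).
- exact: closed_closure.
- by apply: compact_setX; [exact: compact_closure_Omega|exact: segment_compact].
- by move=> p /closure_cylinder[? ?]; split => //=; rewrite in_itv.
Qed.

Variable u : 'rV[R]_n.+1 * R -> R.
Hypothesis u_continuous : {within CQ, continuous u}.
Hypothesis u_boundary : forall p, parabolic_boundary Omega T p -> 0 <= u p.

(** The parabolic boundary omits the points over the boundary of [Omega] at the times
    0 and T; there the sign of u is inherited by continuity from the times strictly
    in between. *)
Lemma cylinder_of_neg p : CQ p -> u p < 0 -> Q p.
Proof.
case: p => x t cp up; have /closure_cylinder[/= cx /andP[t0 tT]] := cp.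
have [Ox|nOx] := pselect (Omega x).
  split => //=; rewrite tT andbT lt_neqAle t0 andbT.
  apply: contraTN up => /eqP t00; rewrite -leNgt.
  by apply: u_boundary; right.
exfalso; move: up; rewrite ltNge => /negP; apply.
have bx : boundary Omega x by split => // /interior_subset.
apply: (@within_closure_ge0 _ _ CQ [set p | p.1 = x /\ 0 < p.2 < T]) => //.
- move=> [y s] /= [-> /andP[s0 sT]]; apply/closure_cylinder; split => //=.
  by rewrite !ltW.
- move=> P [[B C] /= [nB nC] HBC].
  have /nbhs_ballP[e /= e0 eC] := nC.
  have [d [d0 d1 d2]] : exists d, [/\ 0 < d, d <= e / 2 & d <= T / 4].
    exists (Num.min (e / 2) (T / 4)); split; first by rewrite lt_min !divr_gt0.
      by rewrite ge_min lexx.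
    by rewrite ge_min lexx orbT.
  have [s [s0 sT st]] : exists s : R, [/\ 0 < s, s < T & `|t - s| <= d].
    have [tT2|tT2] := ltP (t : R) (T / 2).
      exists (t + d); split; [lra|lra|].
      by rewrite opprD addNKr normrN gtr0_norm.
    exists (t - d); split; [lra|lra|].
    by rewrite opprB addrC subrK gtr0_norm.
  exists (x, s); split => /=.
    by rewrite s0 sT.
  apply: HBC; split => /=; first exact: nbhs_singleton.
  by apply: eC; rewrite /ball/= (le_lt_trans st)//; lra.
- by move=> [y s] /= [-> s0T]; apply: u_boundary; left.
Qed.

End parabolic_cylinder.

(** * The nonlocal minimum principle and the theorem *)

Section nonlocal_minimum.
Context {R : realType} {n : nat} (Omega : set 'rV[R]_n).
Hypothesis oOmega : open Omega.
Variables (lambda : nat -> R) (phi : nat -> 'rV[R]_n -> R).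
Hypothesis eigenbasis : dirichlet_eigenbasis Omega lambda phi.
Local Notation mu := (lebesgue_rV n).

(** If g were positive almost everywhere on {w < a}, then g (max (w, a) - w), which
    vanishes elsewhere, would be nonnegative; its integral being nonpositive, it would
    vanish almost everywhere, and the open nonempty set {w < a} would be negligible. *)
Lemma frac_laplacian_sublevel (alpha a : R) (w g : 'rV[R]_n -> R) x0 :
  0 < alpha < 1 -> a < 0 -> {within Omega, continuous w} ->
  is_frac_laplacian Omega lambda phi alpha w g ->
  Omega x0 -> w x0 < a ->
  ~ {ae mu, forall x, Omega x -> w x < a -> 0 < g x}.
Proof.
move=> alpha01 a0 cw Hg Ox0 wx0 g0.
have mOmega : measurable Omega by exact: measurable_rV_open.
have := inner_frac_laplacian_le0 mOmega eigenbasis alpha01 a0 Hg.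
have [[Lw _] Lg _] := Hg.
set psi := fun x => _ => le0.
have Lpsi : in_L2 Omega psi by apply: in_L2B => //; exact: in_L2_maxr.
have psi_eq x : psi x = if w x < a then a - w x else 0.
  by rewrite /psi; case: ltP => // _; rewrite subrr.
pose U := [set x | Omega x /\ w x < a].
have oU : open U.
  rewrite openE => x [Ox wxa].
  have cx : {for x, continuous w}.
    by move: cw; rewrite (continuous_open_subspace w oOmega); apply; rewrite inE.
  apply: filterI; first exact: open_nbhs_nbhs.
  exact: (cvgr_lt _ cx _ wxa).
have := lebesgue_rV_open_gt0 oU (ex_intro _ x0 (conj Ox0 wx0)).
have mU := measurable_rV_open oU.
suff : mu U = 0%E by move=> ->; rewrite ltxx.
have iF := in_L2_mul_integrable mOmega Lg Lpsi.
have mF := measurable_int _ iF.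
have F0 : {ae mu, forall x, Omega x -> 0 <= g x * psi x}.
  apply: filterS g0 => x H Ox; rewrite psi_eq; case: ifP => [wa|_]; last by rewrite mulr0.
  by rewrite mulr_ge0 ?subr_ge0 ?ltW// H.
have absF : (\int[mu]_(x in Omega) `|(g x * psi x)%:E| = 0)%E.
  rewrite -(@ae_eq_integral _ _ _ mu Omega (fun x => `|(g x * psi x)%:E|%E) (EFin \o (fun x => g x * psi x)))//.
  - apply/eqP; rewrite eq_le; apply/andP; split.
      have := le0; rewrite -lee_fin /inner /Rintegral fineK//.
      exact: integrable_fin_num iF.
    rewrite (@ae_eq_integral _ _ _ mu Omega (fun x => `|(g x * psi x)%:E|%E))//.
    + by apply: integral_ge0.
    + exact: measurableT_comp.
    + by apply: filterS F0 => x H Ox; rewrite gee0_abs// lee_fin H.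
  - exact: measurableT_comp.
  - by apply: filterS F0 => x H Ox; rewrite gee0_abs// lee_fin H.
have /ae_eq_integral_abs := absF => /(_ mOmega mF) F00.
have : {ae mu, forall x, ~ U x}.
  apply: filterS2 g0 F00 => x gx Fx [Ox wa].
  have := Fx Ox; rewrite psi_eq wa => -[] /eqP.
  by rewrite mulf_eq0 !gt_eqF ?subr_gt0// gx.
move=> [N [mN muN UN]].
apply: (subset_measure0 mU mN _ muN) => x Ux.
by apply: UN => /(_ Ux).
Qed.

End nonlocal_minimum.

Theorem lemma4p3 (R : realType) (n : nat) (Omega : set 'rV[R]_n.+1)
    (lambda : nat -> R) (phi : nat -> 'rV[R]_n.+1 -> R)
    (alpha eps T k0 c0 : R) (k u : 'rV[R]_n.+1 * R -> R) (c : R -> R)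
    (Omega_domain : is_domain Omega)
    (Omega_bounded : bounded_set Omega)
    (Omega_lipschitz : lipschitz_boundary Omega)
    (eigenbasis : dirichlet_eigenbasis Omega lambda phi)
    (alpha01 : 0 < alpha < 1) (eps_gt0 : 0 < eps) (T_gt0 : 0 < T)
    (k_bounded : exists M : R, forall p, cylinder Omega T p -> `|k p| <= M)
    (k_continuous : {within cylinder Omega T, continuous k})
    (k0_gt0 : 0 < k0) (k_ge : forall p, cylinder Omega T p -> k0 <= k p)
    (c0_gt0 : 0 < c0) (c_ge : forall s : R, - c0 <= c s)
    (u_C11 : C11 Omega T u)
    (u_continuous : {within closure (cylinder Omega T), continuous u})
    (u_Hs : continuous_in_Hs Omega T lambda phi (2 * alpha) u)
    (u_ineq : forall t, 0 < t <= T ->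
      exists2 g, is_frac_laplacian Omega lambda phi alpha (fun x => u (x, t)) g &
      {ae lebesgue_rV n.+1, forall x, Omega x ->
        0 <= k (x, t) * dt T u (x, t)
             + (eps ^+ 2 * g x + \sum_(i < n.+1) dx u i (x, t))
             + c (u (x, t)) * u (x, t)})
    (u_boundary : forall p, parabolic_boundary Omega T p -> 0 <= u p) :
  exists2 m : R, is_min (closure (cylinder Omega T)) u m & 0 <= m.
Proof.
have [[x1 Ox1] oOmega _] := Omega_domain.
set CQ := closure (cylinder Omega T).
have cCQ : compact CQ by exact: compact_closure_cylinder.
have CQ0 : CQ !=set0.
  by exists (x1, T); apply: subset_closure; split => //=; rewrite T_gt0 lexx.
have [p1 p1C min1] := compact_EVT_min CQ0 cCQ u_continuous.
rewrite inE in p1C.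
exists (u p1).
  by split; [exists p1|move=> p Cp; apply: min1; rewrite inE].
rewrite leNgt; apply/negP => up1.
(* At a minimizer, k d_t u <= k0 beta m / 2 = 2 c0 m, twice the amount that makes
   up for the term - c0 m. *)
pose beta := 4 * c0 / k0; have beta0 : 0 < beta by rewrite divr_gt0 ?mulr_gt0.
pose v (p : 'rV[R]_n.+1 * R) := expR (- (beta * p.2)) * u p.
have cv : {within CQ, continuous v}.
  have cE : continuous (fun p : 'rV[R]_n.+1 * R => expR (- (beta * p.2))).
    move=> p; apply: continuous_comp; last exact: continuous_expR.
    by apply: cvgN; apply: cvgMl_tmp; exact: cvg_snd.
  have cE' : {within CQ, continuous (fun p : 'rV[R]_n.+1 * R => expR (- (beta * p.2)))}.
    exact: continuous_subspaceT.
  by move=> p; apply: cvgM; [exact: cE'|exact: u_continuous].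
have [[x0 t0] + min0] := compact_EVT_min CQ0 cCQ cv; rewrite inE => p0C.
have up0 : u (x0, t0) < 0.
  have : v (x0, t0) < 0.
    apply: le_lt_trans (min0 p1 _) _; first by rewrite inE.
    by rewrite /v pmulr_rlt0 ?expR_gt0.
  by rewrite /v pmulr_rlt0 ?expR_gt0.
have negQ p : CQ p -> u p < 0 -> cylinder Omega T p.
  by move=> Cp up; exact: (cylinder_of_neg Omega_bounded T_gt0 u_continuous).
have [/= Ox0 t0T] := negQ _ p0C up0.
have t0cc : 0 <= t0 <= T by case/andP: t0T => /ltW -> ->.
have CQt0 x : closure Omega x -> CQ (x, t0) by move=> cx; apply/closure_cylinder.
pose w x := u (x, t0); pose m := w x0.
have m0 : m < 0 by [].
have wmin x : closure Omega x -> m <= w x.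
  move=> /CQt0 Cx; have := min0 (x, t0); rewrite inE => /(_ Cx).
  by rewrite /v/= ler_pM2l// expR_gt0.
have [C1 C2 C3 C4] := u_C11.
have Qt0 x : Omega x -> cylinder Omega T (x, t0) by move=> Ox; split.
(* Where w < 0 one has c (w) w <= - c0 w, so the inequality reads
   eps^2 g + h >= 0 there. *)
pose h x := k (x, t0) * dt T u (x, t0) + \sum_(i < n.+1) dx u i (x, t0) - c0 * w x.
have cw : {within closure Omega, continuous w}.
  by apply: within_slice u_continuous _ => x; exact: CQt0.
have cwO : {within Omega, continuous w}.
  by apply: continuous_subspaceW cw; exact: subset_closure.
have ch : {in Omega, continuous h}.
  have S (f : 'rV[R]_n.+1 * R -> R) : {within cylinder Omega T, continuous f} ->
      {in Omega, continuous (fun x => f (x, t0))}.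
    by move=> cf; rewrite -continuous_open_subspace//; exact: within_slice cf Qt0.
  move=> x Ox.
  have ck := S _ k_continuous x Ox; have cdt := S _ C4 x Ox.
  have cdx : {for x, continuous (fun y => \sum_(i < n.+1) dx u i (y, t0))}.
    by apply: continuous_at_sum => i; exact: (S _ (C3 i) x Ox).
  have cwx : {for x, continuous w}.
    by move: cwO; rewrite continuous_open_subspace//; exact.
  exact: (continuousB (continuousD (continuousM ck cdt) cdx)
    (continuousM (@cst_continuous _ _ c0 x) cwx)).
have hmin x : Omega x -> w x = m -> h x < 0.
  move=> Ox wx.
  have dx0 i : dx u i (x, t0) = 0.
    rewrite /dx /pderiv /=; apply: (derive_min oOmega) => //.
      by move=> y Oy; rewrite -[u (x, t0)]/(w x) wx; apply: wmin; exact: subset_closure.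
    exact: (C1 _ (Qt0 _ Ox) i).
  have dt0 : dt T u (x, t0) <= beta / 2 * u (x, t0).
    apply: (@dt_min _ _ _ _ u) => //; first exact: (C2 _ (Qt0 _ Ox)).
      by rewrite -[u (x, t0)]/(w x) wx.
    move=> s s0T.
    have Cs : (x, s) \in CQ.
      by rewrite inE; apply: subset_closure; split.
    have := min0 _ Cs; rewrite /v/= -[u (x0, t0)]/m -wx -[w x]/(u (x, t0)) => H.
    rewrite mulrBr expRD -mulrA.
    by rewrite -[X in expR X * _]opprK expRN mulrC ler_pdivrMr ?expR_gt0// [leRHS]mulrC.
  rewrite /h big1// addr0 wx.
  have kx := k_ge _ (Qt0 _ Ox).
  rewrite -[u (x, t0)]/(w x) wx in dt0.
  have bm : beta / 2 * m < 0 by rewrite nmulr_llt0// divr_gt0.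
  have : k (x, t0) * dt T u (x, t0) <= k0 * (beta / 2 * m) by nra.
  rewrite (_ : k0 * (beta / 2 * m) = 2 * c0 * m); last first.
    by rewrite /beta; field; rewrite gt_eqF.
  have : c0 * m < 0 by rewrite nmulr_llt0.
  lra.
have [a [ma a0 ha]] : exists a, [/\ m < a, a < 0 &
    forall x, Omega x -> w x < a -> h x < 0].
  pose V := [set x | Omega x /\ h x < 0].
  have oV : open V.
    rewrite openE => x [Ox hx]; apply: filterI; first exact: open_nbhs_nbhs.
    by apply: (cvgr_lt _ (ch x _) _ hx); rewrite inE.
  (* Off V the function w exceeds m, hence, by compactness, some a > m. *)
  pose C := closure Omega `&` ~` V.
  have cC : compact C.
    apply: compact_closedI; last by rewrite closedC.
    exact: compact_closure_Omega.
  have [C0|C0] := pselect (C !=set0); last first.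
    exists (m / 2); split; [lra|lra|move=> x Ox _].
    apply: contrapT => hx; apply: C0; exists x; split; first exact: subset_closure.
    by move=> [].
  have cwC : {within C, continuous w} by apply: continuous_subspaceW cw => ? [].
  have [y yC ymin] := compact_EVT_min C0 cC cwC.
  rewrite inE in yC; have [cy nVy] := yC.
  have my : m < w y.
    rewrite lt_neqAle wmin// andbT; apply/eqP => my; apply: nVy.
    have [Oy _] : cylinder Omega T (y, t0).
      by apply: negQ; [exact: CQt0|rewrite -[u _]/(w y) -my].
    by split => //; exact: hmin.
  exists (Num.min (w y) (m / 2)); split.
  - by rewrite lt_min my/=; lra.
  - by rewrite gt_min; apply/orP; right; lra.
  - move=> x Ox; rewrite lt_min => /andP[wy _]; apply: contrapT => hx.
    have xC : x \in C by rewrite inE; split; [exact: subset_closure|move=> []].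
    by have := ymin _ xC; rewrite leNgt wy.
have [g Hg gineq] := u_ineq _ t0T.
apply: (frac_laplacian_sublevel oOmega eigenbasis alpha01 a0 cwO Hg Ox0 ma).
apply: filterS gineq => x Hx Ox wxa.
have := Hx Ox; have := ha x Ox wxa; rewrite /h -[u (x, t0)]/(w x).
have wx0 : w x < 0 by exact: lt_trans a0.
have cx : c (w x) * w x <= - c0 * w x by rewrite ler_wnM2r// ltW.
have e2 : 0 < eps ^+ 2 by rewrite exprn_gt0.
move=> h1 h2; rewrite -(pmulr_rgt0 _ e2); lra.
Qed.
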